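(* The rational intersection problem is not semidecidable. That is, there is no algorithm that, given as input two multi-tape finite-state automata $A$ and $B$ over a common finite alphabet $\Sigma$, halts with a positive answer exactly when the language $\mathcal{L}(A) \cap \mathcal{L}(B)$ is rational (i.e., accepted by some multi-tape finite-state automaton), and runs forever otherwise.
   Context: An $n$-tape finite-state automaton is a tuple $\langle \Sigma, Q, \delta, Q_0, F, T, \tau\rangle$ where $\Sigma$ is a finite input alphabet with an end-marker $\$ \notin \Sigma$ (write $\Sigma_\$ = \Sigma\cup\{\$\}$), $T=\{t_1,\dots,t_n\}$ is the set of tapes, $Q$ is a finite set of states, $\tau: Q\to T$ assigns to each state the tape read in that state, $\delta: Q\times\Sigma_\$ \to 2^Q$ is a (nondeterministic) transition function, $Q_0\subseteq Q$ are initial states and $F\subseteq Q$ accepting states. A configuration is $\langle q, y_1,\dots,y_n\rangle$ with $q\in Q$ and $y_k\in\Sigma_\$^*$ the unread remainder of tape $k$. A run on input $\langle x_1,\dots,x_n\rangle\in(\Sigma^* )^n$ is a sequence of configurations starting at $\langle q_0, x_1\$,\dots,x_n\$\rangle$ with $q_0\in Q_0$, where from $\langle q,y_1,\dots,y_n\rangle$ with $\tau(q)=t_h$ and $y_h=\sigma y_h'$ ($\sigma\in\Sigma_\$$) one moves to $\langle q', y_1,\dots,y_h',\dots,y_n\rangle$ with $q'\in\delta(q,\sigma)$ (other tapes unchanged). The run is accepting if it ends in a state of $F$; $\mathcal{L}(A)$ is the set of $n$-tuples of words having an accepting run. The heads move independently (asynchronously). A language of $n$-tuples of words is rational if it is $\mathcal{L}(A)$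 for some $n$-tape automaton $A$. Intersected automata share the tapes with the same names; if $L_1$ is a language of $n$-tuples and $L_2$ of $m$-tuples with $m\ge n$, $L_1\cap L_2$ is the set of $\langle x_1,\dots,x_m\rangle \in L_2$ with $\langle x_1,\dots,x_n\rangle\in L_1$. *)

(* Defs.v *)
From mathcomp Require Import all_boot.

Set Implicit Arguments.
Unset Strict Implicit.
Unset Printing Implicit Defensive.

(* The end-marked alphabet is [option Sigma]: the letters are the [Some a], and
   [None] is the end-marker.  Tapes are named by ['I_n]. *)
Record automaton (Sigma : finType) (n : nat) := Automaton {
  state : finType;
  tape_of : state -> 'I_n;
  delta : state -> option Sigma -> {set state};
  initial : {set state};
  accepting : {set state} }.

Definition language (Sigma : finType) (n : nat) := n.-tuple (seq Sigma) -> Prop.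

Section Semantics.
Variables (Sigma : finType) (n : nat).

(* The current state, and the unread remainder of each tape. *)
Definition config (A : automaton Sigma n) : Type :=
  (state A * n.-tuple (seq (option Sigma)))%type.

Definition move (A : automaton Sigma n) : rel (config A) := fun c c' =>
  if tnth c.2 (tape_of c.1) is s :: y then
    (c'.1 \in delta c.1 s) &&
    (c'.2 == [tuple if k == tape_of c.1 then y else tnth c.2 k | k < n])
  else false.

Definition end_marked (w : seq Sigma) : seq (option Sigma) :=
  rcons (map Some w) None.

Definition start (A : automaton Sigma n) (q : state A) (x : n.-tuple (seq Sigma)) :
  config A := (q, map_tuple end_marked x).

(* A run need not consume its input: it is accepting as soon as its last
   configuration is in an accepting state. *)
Definition lang (A : automaton Sigma n) : language Sigma n := fun x =>
  exists (q0 : state A) (run : seq (config A)),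
    [/\ q0 \in initial A, path (@move A) (start q0 x) run
      & (last (start q0 x) run).1 \in accepting A].

Definition rational (L : language Sigma n) : Prop :=
  exists A : automaton Sigma n, forall x, L x <-> lang A x.

End Semantics.

Definition lang_cap (Sigma : finType) (n m : nat) (le_nm : n <= m)
    (L1 : language Sigma n) (L2 : language Sigma m) : language Sigma m :=
  fun x => L1 [tuple tnth x (widen_ord le_nm k) | k < n] /\ L2 x.

(* Minsky register machines.  [Inc r l] increments register [r] and jumps to
   [l]; [Dec r l l0] decrements [r] and jumps to [l] if [r] is nonzero, and jumps
   to [l0] otherwise.  A jump outside the program halts the machine. *)
Inductive instr := Inc of nat & nat | Dec of nat & nat & nat.

Definition machine := seq instr.

Definition set_reg (R : nat -> nat) (r v : nat) : nat -> nat :=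
  fun r' => if r' == r then v else R r'.

Definition mstep (M : machine) (c : nat * (nat -> nat)) : nat * (nat -> nat) :=
  let: (pc, R) := c in
  match onth M pc with
  | None => c
  | Some (Inc r l) => (l, set_reg R r (R r).+1)
  | Some (Dec r l l0) =>
      if R r is v.+1 then (l, set_reg R r v) else (l0, R)
  end.

(* On input [x], register 0 initially holds [x] and all others hold 0. *)
Definition mhalts (M : machine) (x : nat) : Prop :=
  exists t, size M <= (iter t (mstep M) (0, set_reg (fun=> 0) 0 x)).1.

(* A problem on a type [I] of finite objects presented by Gödel numbers is
   semidecidable when some machine halts exactly on the positive instances. *)
Definition semidecidable (I : Type) (godel : I -> nat) (P : I -> Prop) : Prop :=
  exists M : machine, forall i : I, mhalts M (godel i) <-> P i.

Record instance := Instance {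
  alphabet : finType;
  arityA : nat;
  arityB : nat;
  arityA_gt0 : 0 < arityA;
  arityAB : arityA <= arityB;
  autA : automaton alphabet arityA;
  autB : automaton alphabet arityB }.

Definition rational_intersection (i : instance) : Prop :=
  rational (lang_cap (arityAB i) (lang (autA i)) (lang (autB i))).

(* Gödel numbers: [CodeSeq.code] is a computable bijection from [seq nat] to
   [nat].  States and letters are numbered by their rank in the enumeration of
   their type (the end-marker coming first in [option Sigma]), so that the Gödel
   number of an instance determines it up to a renaming of states and letters. *)
Definition code_set (T : finType) (X : {set T}) : nat :=
  CodeSeq.code [seq nat_of_ord (enum_rank q) | q in X].

Definition code_automaton (Sigma : finType) (n : nat) (A : automaton Sigma n) : nat :=
  CodeSeq.code
    [:: #|state A|;
        CodeSeq.code [seq nat_of_ord (tape_of q) | q : state A];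
        CodeSeq.code [seq CodeSeq.code [seq code_set (delta q s) | s : option Sigma]
                     | q : state A];
        code_set (initial A);
        code_set (accepting A)].

Definition code_instance (i : instance) : nat :=
  CodeSeq.code [:: #|alphabet i|; arityA i; arityB i;
                   code_automaton (autA i); code_automaton (autB i)].

(* Main.v *)
From HB Require Import structures.
From mathcomp Require Import all_boot zify.
Require Import Defs.

(* Words over [bool] are lists of numbers in unary.  A machine [D] with [k]
   registers has configurations [pc, R_0, ..., R_(k-1)].  One two-tape automaton,
   depending on [D] only, accepts the pairs (c_0 ... c_(m-1) c, d_0 ... d_(m-1))
   in which [D] steps from each c_i to d_i and [c] is halted; another one,
   depending on a number [x] only, accepts the pairs (c_0 w, w) with
   c_0 = (0, x, 0, ..., 0, n) for some [n].  In the intersection the second tape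
   is the first one shifted by a configuration, so its elements are the halting
   runs of [D] on input [x], for every value [n] of a register that [D] does not
   use.  If [D] diverges on [x] the intersection is empty, hence rational; if [D]
   halts, it is not rational, since a finite-state head leaving c_0 on the first
   tape cannot remember [n].  Suppose now that a machine [M] semidecides
   rationality.  Let [x] be the code of the first automaton, for the machine [D]
   that computes the code of the instance from [x] and then runs [M] on it: [D]
   halts on [x] if and only if it does not. *)

Set Implicit Arguments.
Unset Strict Implicit.
Unset Printing Implicit Defensive.

(** * Register machines *)

Section RegisterMachines.
Implicit Types (M p q : machine) (R : nat -> nat) (c : nat * (nat -> nat)).

Definition halts M c := exists t, size M <= (iter t (mstep M) c).1.

Definition reach M c c' := exists t, iter t (mstep M) c = c'.

Lemma reach_trans M c1 c2 c3 : reach M c1 c2 -> reach M c2 c3 -> reach M c1 c3.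
Proof. by move=> [t <-] [u <-]; exists (u + t); rewrite iterD. Qed.

Lemma reach_step M c c' : mstep M c = c' -> reach M c c'.
Proof. by exists 1. Qed.

Lemma mstep_halted M c : size M <= c.1 -> mstep M c = c.
Proof. by case: c => pc R /= h; rewrite onth_default. Qed.

Lemma halts_step M c : halts M (mstep M c) <-> halts M c.
Proof.
split=> [[t ht]|[[|t] ht]]; first by exists t.+1; rewrite iterSr.
  by exists 0; rewrite /= mstep_halted.
by exists t; rewrite -iterSr.
Qed.

Lemma halts_reach M c c' : reach M c c' -> halts M c' <-> halts M c.
Proof.
move=> [t <-]; elim: t => [|t IHt] //=.
by rewrite halts_step.
Qed.

(** Jump targets are absolute, so a fragment is generated for the address [l] at which it occurs;
    the rest of [M] is left open. *)
Definition code_at M l p :=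
  forall i ins, onth p i = Some ins -> onth M (l + i) = Some ins.

Lemma code_at_catl M l p q : code_at M l (p ++ q) -> code_at M l p.
Proof.
move=> h i ins e; apply: h; rewrite onth_cat -onthTE e //.
Qed.

Lemma code_at_catr M l p q : code_at M l (p ++ q) -> code_at M (l + size p) q.
Proof.
move=> h i ins e; rewrite -addnA; apply: h.
by rewrite onth_cat ltnNge leq_addr addKn.
Qed.

Lemma code_at_cons M l ins p :
  code_at M l (ins :: p) -> onth M l = Some ins /\ code_at M l.+1 p.
Proof.
move=> h; split; first by rewrite -(h 0 _ erefl) addn0.
by move=> i ins' e; rewrite addSnnS; apply: h.
Qed.

Lemma set_regE R r v r' : set_reg R r v r' = if r' == r then v else R r'.
Proof. by []. Qed.

Lemma step_inc M pc R r l :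
  onth M pc = Some (Inc r l) -> reach M (pc, R) (l, set_reg R r (R r).+1).
Proof. by move=> e; apply: reach_step; rewrite /= e. Qed.

Lemma step_dec0 M pc R r l l0 : onth M pc = Some (Dec r l l0) -> R r = 0 ->
  reach M (pc, R) (l0, R).
Proof. by move=> e h; apply: reach_step; rewrite /= e h. Qed.

Lemma step_decS M pc R r l l0 v : onth M pc = Some (Dec r l l0) -> R r = v.+1 ->
  reach M (pc, R) (l, set_reg R r v).
Proof. by move=> e h; apply: reach_step; rewrite /= e h. Qed.

Definition clear r l := [:: Dec r l l.+1].

Definition transfer r s l e := [:: Dec r l.+1 e; Inc s l].

(** A register can only be read by emptying it, so a copy is made twice and the second one is later
    transferred back to the source. *)
Definition copy2 r s s' l :=
  [:: Dec r l.+1 l.+3; Inc s l.+2; Inc s' l].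

Lemma clear_spec M r l R : code_at M l (clear r l) ->
  exists2 R', reach M (l, R) (l.+1, R') &
    forall i, R' i = if i == r then 0 else R i.
Proof.
move=> h; have {}h := h 0 _ erefl; rewrite addn0 in h.
move E: (R r) => v; elim: v R E => [|v IHv] R E.
  exists R; first exact: step_dec0 h E.
  by move=> i; case: eqP => // ->.
have [|R' h1 h2] := IHv (set_reg R r v); first by rewrite set_regE eqxx.
exists R'; first exact: reach_trans (step_decS h E) h1.
by move=> i; rewrite h2 set_regE; case: eqP.
Qed.

Lemma transfer_spec M r s l e R : r != s -> code_at M l (transfer r s l e) ->
  exists2 R', reach M (l, R) (e, R') &
    forall i, R' i = if i == r then 0 else if i == s then R s + R r else R i.
Proof.
move=> rs h; have h0 := h 0 _ erefl; have {}h := h 1 _ erefl.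
rewrite addn0 in h0; rewrite addn1 in h.
move E: (R r) => v; elim: v R E => [|v IHv] R E.
  exists R; first exact: step_dec0 h0 E.
  by move=> i; case: eqP => [->//|_]; case: eqP => // ->; rewrite addn0.
pose R1 := set_reg R r v.
have [|R' h1 h2] := IHv (set_reg R1 s (R1 s).+1).
  by rewrite set_regE (negPf rs) /R1 set_regE eqxx.
exists R'; first exact: reach_trans (step_decS h0 E) (reach_trans (step_inc _ h) h1).
move=> i; rewrite h2 /R1 !set_regE eqxx (eq_sym s) (negPf rs); case: eqP => // _.
by case: eqP => // _; rewrite addSnnS.
Qed.

Lemma copy2_spec M r s s' l R : r != s -> r != s' -> s != s' ->
  code_at M l (copy2 r s s' l) ->
  exists2 R', reach M (l, R) (l.+3, R') &
    forall i, R' i = if i == r then 0 else if i == s then R s + R r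
                     else if i == s' then R s' + R r else R i.
Proof.
move=> rs rs' ss' h.
have h0 := h 0 _ erefl; have h1 := h 1 _ erefl; have {h}h2 := h 2 _ erefl.
rewrite addn0 in h0; rewrite addn1 in h1; rewrite addn2 in h2.
move E: (R r) => v; elim: v R E => [|v IHv] R E.
  exists R; first exact: step_dec0 h0 E.
  move=> i; case: eqP => [->//|_]; case: eqP => [->|_]; first by rewrite addn0.
  by case: eqP => // ->; rewrite addn0.
pose R1 := set_reg R r v; pose R2 := set_reg R1 s (R1 s).+1.
have [|R' h3 h4] := IHv (set_reg R2 s' (R2 s').+1).
  by rewrite /R2 /R1 !set_regE eqxx (negPf rs) (negPf rs').
exists R'.
  apply: reach_trans (step_decS h0 E) (reach_trans (step_inc _ h1) _).
  exact: reach_trans (step_inc _ h2) h3.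
move=> i; rewrite h4 /R2 /R1 !set_regE !eqxx.
have -> : (s == r) = false by lia.
have -> : (s' == r) = false by lia.
have -> : (s' == s) = false by lia.
case: (eqVneq i r) => // _; rewrite (negPf ss') addSnnS.
by case: (eqVneq i s) => // _; rewrite addSnnS; case: eqP.
Qed.

(* Primitive recursion, in de Bruijn notation: [Rec n b s] runs the step [s] for
   the index going down from [n - 1] to 0, with variable 0 of [s] the
   accumulator and variable 1 the index. *)
Inductive term := Var of nat | Zero | Suc of term | Rec of term & term & term.

Fixpoint downto (n : nat) (f : nat -> nat -> nat) (acc : nat) : nat :=
  if n is k.+1 then downto k f (f k acc) else acc.

Fixpoint eval (t : term) (env : seq nat) : nat :=
  match t with
  | Var i => nth 0 env i
  | Zero => 0
  | Suc t => (eval t env).+1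
  | Rec n b s =>
      downto (eval n env) (fun k acc => eval s [:: acc, k & env]) (eval b env)
  end.

Fixpoint closed (d : nat) (t : term) : bool :=
  match t with
  | Var i => i < d
  | Zero => true
  | Suc t => closed d t
  | Rec n b s => [&& closed d n, closed d b & closed d.+2 s]
  end.

(* The code placed at address [l] leaves the value of the term in register [d].
   Variable [i] lives in the register [vs`_i < d], and the registers above [d]
   are scratch. *)
Fixpoint compile (vs : seq nat) (d : nat) (t : term) (l : nat) : machine :=
  match t with
  | Var i =>
      clear d l ++ clear d.+1 l.+1 ++ copy2 (nth 0 vs i) d d.+1 l.+2 ++
      transfer d.+1 (nth 0 vs i) (l + 5) (l + 7)
  | Zero => clear d l
  | Suc t => let c := compile vs d t l in c ++ [:: Inc d (l + size c).+1]
  | Rec n b s =>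
      let cn := compile vs d n l in
      let l1 := l + size cn in
      let cb := compile vs d.+1 b l1 in
      let l2 := l1 + size cb in
      let cs := compile [:: d.+1, d & vs] d.+2 s l2.+1 in
      let l3 := l2.+1 + size cs in
      cn ++ cb ++ [:: Dec d l2.+1 (l3 + 3)] ++ cs ++
      clear d.+1 l3 ++ transfer d.+2 d.+1 l3.+1 l2 ++
      transfer d.+1 d (l3 + 3) (l3 + 5)
  end.

Definition holds_env (vs : seq nat) (d : nat) (env : seq nat) R :=
  all (ltn^~ d) vs /\ map R vs = env.

Lemma holds_env_ext vs d env R R' : (forall i, i < d -> R' i = R i) ->
  holds_env vs d env R -> holds_env vs d env R'.
Proof.
move=> e [hd h]; split=> //; rewrite -h.
by apply/eq_in_map => v /(allP hd) /e.
Qed.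

Lemma holds_envW vs d d' env R : d <= d' -> holds_env vs d env R ->
  holds_env vs d' env R.
Proof.
move=> dd' [hd h]; split=> //.
by apply: sub_all hd => v /= /leq_trans; apply.
Qed.

Lemma holds_env_cons vs d env R v : holds_env vs d env R -> v < d ->
  holds_env (v :: vs) d (R v :: env) R.
Proof. by move=> [/= hd h] hv; split=> /=; rewrite ?hv ?h. Qed.

(** Induction on the term. In a [Rec], register [d] counts down and [d.+1] accumulates; the counter
    is decremented before the step, so that it then holds the index. The step is compiled for
    register [d.+2], and by the last clause it preserves the counter, the accumulator and the
    environment. Registers are described pointwise throughout, as functions are not compared
    extensionally. *)
Lemma compile_spec M t vs d l env R :
  code_at M l (compile vs d t l) -> closed (size vs) t -> holds_env vs d env R ->
  exists R', [/\ reach M (l, R) (l + size (compile vs d t l), R'),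
    R' d = eval t env & forall i, i < d -> R' i = R i].
Proof.
elim: t vs d l env R => [i||t IHt|n IHn b IHb s IHs] vs d l env R.
- move=> + /= id [hd henv]; set r := nth 0 vs i => hc.
  have rd : r < d by apply: (allP hd); apply: mem_nth.
  have h1 := code_at_catl hc; have {}hc := code_at_catr hc.
  rewrite [size _]/= addn1 in hc.
  have h2 := code_at_catl hc; have {}hc := code_at_catr hc.
  rewrite [size _]/= addn1 in hc.
  have h3 := code_at_catl hc; have {hc}h4 := code_at_catr hc.
  have e5 : l.+2 + 3 = l + 5 by lia.
  rewrite [size _]/= e5 in h4.
  have [R1 s1 e1] := clear_spec R h1.
  have [R2 s2 e2] := clear_spec R1 h2.
  have [|||R3 s3 e3] := copy2_spec R2 _ _ _ h3; try by lia.
  have [|R4 s4 e4] := transfer_spec R3 _ h4; first by lia.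
  rewrite -e5 in s4.
  exists R4; split.
  + have -> : l + 7 = l.+4.+3 by lia.
    apply: reach_trans s1 (reach_trans s2 (reach_trans s3 _)).
    by move: s4; rewrite addn3; have -> : l + 7 = l.+4.+3 by lia.
  + have n1 : (d == d.+1) = false by lia.
    have n2 : (d == r) = false by lia.
    have n3 : (r == d.+1) = false by lia.
    have n4 : (r == d) = false by lia.
    rewrite -henv (nth_map 0) // -/r e4 n1 n2 e3 n2 eqxx !e2 n1 n3 !e1 eqxx n4.
    by rewrite add0n.
  + move=> j jd.
    have m1 : (j == d.+1) = false by lia.
    have m2 : (j == d) = false by lia.
    have n1 : (d.+1 == r) = false by lia.
    have n2 : (d.+1 == d) = false by lia.
    have n3 : (r == d.+1) = false by lia.
    have n4 : (r == d) = false by lia.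
    rewrite e4 !e3 !e2 !e1 !eqxx m1 m2 n1 n2 n3 n4.
    by case: eqP => [->|].
- move=> h _ _; have [R' h1 h2] := clear_spec R h.
  exists R'; rewrite /= addn1; split=> //; first by rewrite h2 eqxx.
  by move=> i id; rewrite h2 ltn_eqF.
- move=> /= hc ht henv.
  have [R1 [s1 e1 f1]] := IHt _ _ _ _ _ (code_at_catl hc) ht henv.
  have {}hc := code_at_catr hc; have {}hc := hc 0 _ erefl; rewrite addn0 in hc.
  eexists; split.
  + rewrite size_cat /= addn1 addnS.
    exact: reach_trans s1 (step_inc _ hc).
  + by rewrite set_regE eqxx e1.
  + by move=> i id; rewrite set_regE ltn_eqF // f1.
- move=> hc /= /and3P[hn hb hs] henv; move: hc.
  rewrite /compile -/compile.
  set cn := compile vs d n l; set l1 := l + size cn.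
  set cb := compile vs d.+1 b l1; set l2 := l1 + size cb.
  set cs := compile _ d.+2 s l2.+1; set l3 := l2.+1 + size cs => hc.
  have h1 := code_at_catl hc; have {}hc := code_at_catr hc.
  have h2 := code_at_catl hc; have {}hc := code_at_catr hc.
  rewrite -/l1 -/l2 in h2 hc.
  have [h3 _] := code_at_cons (code_at_catl hc); have {}hc := code_at_catr hc.
  rewrite [size _]/= addn1 in hc.
  have h4 := code_at_catl hc; have {}hc := code_at_catr hc.
  have h5 := code_at_catl hc; have {}hc := code_at_catr hc.
  rewrite -/l3 in h5 hc; rewrite [size _]/= addn1 in hc.
  have h6 := code_at_catl hc; have {hc}h7 := code_at_catr hc.
  have e3 : l3.+1 + 2 = l3 + 3 by lia.
  rewrite [size _]/= e3 in h7.
  have [R1 [s1 v1 f1]] := IHn _ _ _ _ _ h1 hn henv.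
  have env1 : holds_env vs d.+1 env R1.
    by apply: holds_envW (leqnSn d) _; apply: (holds_env_ext _ henv).
  have [R2 [s2 v2 f2]] := IHb _ _ _ _ _ h2 hb env1.
  (* The loop, by induction on the value of the counter, for arbitrary contents of the
     accumulator. *)
  have [R3 [s3 v3 f3]] : exists R3, [/\ reach M (l2, R2) (l3 + 3, R3),
      R3 d.+1 = eval (Rec n b s) env /\ R3 d = 0 & forall i, i < d -> R3 i = R2 i].
    have env2 : holds_env vs d env R2.
      have env1' : holds_env vs d env R1 by apply: (holds_env_ext _ henv).
      by apply: (holds_env_ext _ env1') => i id; rewrite f2 // ltnW.
    have := f2 d (ltnSn d); rewrite v1 /= -v2.
    move: (eval n env) => k {s1 v1 f1 s2 v2 f2 env1 R1}.
    elim: k R2 env2 => [|k IHk] R2 env2 kE /=.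
      by exists R2; split=> //; apply: step_dec0 h3 kE.
    pose R4 := set_reg R2 d k.
    have env4 : holds_env [:: d.+1, d & vs] d.+2 [:: R2 d.+1, k & env] R4.
      have R4d : R4 d = k by rewrite /R4 set_regE eqxx.
      have R4d1 : R4 d.+1 = R2 d.+1 by rewrite /R4 set_regE; case: eqP => //; lia.
      rewrite -R4d -R4d1; do 2!apply: holds_env_cons => //.
      apply: (@holds_envW _ d); first by lia.
      apply: (holds_env_ext _ env2) => i id.
      by rewrite /R4 set_regE ltn_eqF.
    have [R5 [s5 v5 f5]] := IHs _ _ _ _ _ h4 hs env4.
    have [R6 s6 e6] := clear_spec R5 h5.
    have [|R7 s7 e7] := transfer_spec R6 _ h6; first by lia.
    have R7d1 : R7 d.+1 = eval s [:: R2 d.+1, k & env].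
      rewrite e7 !e6 v5 !eqxx add0n.
      by do 2?(case: eqP => [|_]; first by lia).
    have R7E i : i <= d -> R7 i = R4 i.
      move=> id; rewrite e7; do 2?(case: eqP => [|_]; first by lia).
      by rewrite e6 f5; last (by lia); case: eqP => [|_]; first by lia.
    have R7d : R7 d = k by rewrite R7E // /R4 set_regE eqxx.
    have R7f i : i < d -> R7 i = R2 i.
      by move=> id; rewrite R7E 1?ltnW // /R4 set_regE ltn_eqF.
    have [|//|R3 [s3 [v3 z3] f3]] := IHk R7.
      exact: (holds_env_ext _ env2).
    exists R3; split.
    + apply: reach_trans (step_decS h3 kE) _.
      exact: reach_trans s5 (reach_trans s6 (reach_trans s7 s3)).
    + by rewrite v3 R7d1.
    + by move=> i id; rewrite f3 // R7f.
  have [|R4 s4 e4] := transfer_spec R3 _ h7; first by lia.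
  exists R4; split.
  + apply: reach_trans s1 (reach_trans s2 (reach_trans s3 _)).
    rewrite /= !size_cat /= size_cat /= -/cn -/l1 -/cb -/l2 -/cs.
    have -> : l + (size cn + (size cb + (size cs + 5).+1)) = l3 + 5.
      by rewrite /l3 /l2 /l1; lia.
    by [].
  + case: v3 => v3 z3; rewrite e4 z3 v3 eqxx.
    by case: eqP => [|_]; first by lia.
  + move=> i id; rewrite e4; do 2?(case: eqP => [|_]; first by lia).
    by rewrite f3 // f2 1?f1 // ltnW.
Qed.

(** * Running a machine on a computed input *)

Definition instr_reg ins := match ins with Inc r _ | Dec r _ _ => r end.

Definition reg_bound M := \max_(r <- map instr_reg M) r.

Lemma reg_boundP M pc ins :
  onth M pc = Some ins -> instr_reg ins <= reg_bound M.
Proof.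
move=> e; apply: (leq_bigmax_seq (F := id)) => //.
elim: M pc e => [|a M IHM] [|pc] //= => [[->]|/IHM h]; rewrite inE ?eqxx //.
by rewrite h orbT.
Qed.

Definition relocate (off : nat) M : machine :=
  [seq match ins with
       | Inc r l => Inc r (off + l)
       | Dec r l l0 => Dec r (off + l) (off + l0)
       end | ins <- M].

(** The two runs advance in lockstep. They need to agree only below [K], because [M] never touches
    the other registers, where the prefix [p] may have left anything. *)
Lemma relocate_iter p M K R R' t : reg_bound M < K ->
  (forall r, r < K -> R' r = R r) ->
  let c := iter t (mstep M) (0, R) in
  let c' := iter t (mstep (p ++ relocate (size p) M)) (size p, R') in
  c'.1 = size p + c.1 /\ forall r, r < K -> c'.2 r = c.2 r.
Proof.
move=> hK; elim: t => [|t IHt] hR /=; first by rewrite addn0.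
have {IHt}[] := IHt hR.
case: (iter t (mstep M) _) => pc R1; case: (iter t _ _) => pc' R1' /= -> {}hR.
rewrite onth_cat ltnNge leq_addr addKn /= onth_map.
case E: (onth M pc) => [ins|] //; have := reg_boundP E.
case: ins {E} => [r l|r l l0] /= /leq_ltn_trans /(_ hK) rK; rewrite hR //=.
  by split=> // i iK; rewrite !set_regE hR.
case: (R1 r) => [|v] //=; split=> // i iK.
by rewrite !set_regE hR.
Qed.

Definition precompose (K : nat) (g : term) M : machine :=
  let G := compile [:: 0] K g 0 in
  let p := G ++ clear 0 (size G) ++ transfer K 0 (size G).+1 (size G + 3) in
  p ++ relocate (size p) M.

(** The value of [g] is computed in register [K], above the registers of [M], so those still hold 0
    when [M] starts. Nothing is assumed about the registers from [K] on, which leaves room for an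
    arbitrary number in one of them. *)
Lemma precompose_halts M K g x R :
  reg_bound M < K -> closed 1 g -> R 0 = x -> (forall r, 0 < r < K -> R r = 0) ->
  halts (precompose K g M) (0, R) <-> mhalts M (eval g [:: x]).
Proof.
move=> hK hg hx hR; rewrite /precompose.
set G := compile _ _ _ _; set p := G ++ _.
have K0 : 0 < K by case: (K) hK.
have hp : code_at (p ++ relocate (size p) M) 0 p.
  by move=> i ins e; rewrite onth_cat -onthTE e.
have h1 := code_at_catl hp; have {}hp := code_at_catr hp.
have h2 := code_at_catl hp; have {hp}h3 := code_at_catr hp.
rewrite !add0n in h2 h3; rewrite [size (clear _ _)]/= addn1 in h3.
have henv : holds_env [:: 0] K [:: x] R by split; rewrite /= ?K0 ?hx.
have [R1 [s1 v1 f1]] := compile_spec h1 hg henv.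
have [R2 s2 e2] := clear_spec R1 h2.
have [|R3 s3 e3] := transfer_spec R2 _ h3; first by rewrite -lt0n.
have sp : size p = size G + 3 by rewrite /p !size_cat.
have s4 : reach (p ++ relocate (size p) M) (0, R) (size p, R3).
  by rewrite {2}sp; exact: reach_trans s1 (reach_trans s2 s3).
rewrite -(halts_reach s4) /mhalts.
have hR3 r : r < K -> R3 r = set_reg (fun=> 0) 0 (eval g [:: x]) r.
  move=> rK; rewrite e3 set_regE (ltn_eqF rK).
  case: (eqVneq r 0) => [_|r0].
    rewrite !e2 eqxx add0n v1.
    by case: eqP => [E|//]; rewrite E in K0.
  by rewrite e2 (negPf r0) f1 // hR // lt0n r0.
split=> -[t ht]; exists t; move: ht; have [-> _] := relocate_iter p t hK hR3;
  by rewrite size_cat size_map leq_add2l.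
Qed.

End RegisterMachines.

(** * The copying automaton and the code of its instances *)

Section Acceptance.
Variables (Sigma : finType) (n : nat) (A : automaton Sigma n).

Definition acc (c : config A) : Prop :=
  exists2 run, path (@move Sigma n A) c run & (last c run).1 \in accepting A.

Definition put (y : n.-tuple (seq (option Sigma))) (t : 'I_n) v :=
  [tuple if k == t then v else tnth y k | k < n].

Lemma langE x :
  lang A x <-> exists2 q0, q0 \in initial A & acc (start q0 x).
Proof.
split=> [[q0 [run [h1 h2 h3]]]|[q0 h1 [run h2 h3]]]; last by exists q0, run.
by exists q0 => //; exists run.
Qed.

Lemma accE q y : acc (q, y) <-> q \in accepting A \/
  exists s v q', [/\ tnth y (tape_of q) = s :: v, q' \in delta q s &
                     acc (q', put y (tape_of q) v)].
Proof.
split=> [[[|[q' y'] run] /= hp hl]|].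
- by left.
- move/andP: hp => [hm hp]; right.
  move: hm; rewrite /move /=; case E: (tnth _ _) => [|s v] // /andP[hq /eqP hy].
  by exists s, v, q'; split=> //; exists run => //; rewrite /put -hy.
- case=> [h|[s [v [q' [h1 h2 [run h3 h4]]]]]]; first by exists [::].
  exists ((q', put y (tape_of q) v) :: run) => //=.
  by rewrite h3 /move /= h1 h2 eqxx.
Qed.

End Acceptance.

Definition tape0 : 'I_2 := ord0.
Definition tape1 : 'I_2 := ord_max.

Lemma put0 (Sigma : finType) (u v u' : seq (option Sigma)) :
  put [tuple u; v] tape0 u' = [tuple u'; v].
Proof. by apply: eq_from_tnth => i; rewrite tnth_mktuple; case: i => -[|[]]. Qed.

Lemma put1 (Sigma : finType) (u v v' : seq (option Sigma)) :
  put [tuple u; v] tape1 v' = [tuple u; v'].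
Proof. by apply: eq_from_tnth => i; rewrite tnth_mktuple; case: i => -[|[]]. Qed.

Lemma map_tuple2 (T U : Type) (f : T -> U) (u v : T) :
  map_tuple f [tuple u; v] = [tuple f u; f v].
Proof. exact: val_inj. Qed.

Lemma tuple2P (T : Type) (x : 2.-tuple T) : exists u v, x = [tuple u; v].
Proof. by case: x => -[|u [|v []]] // i; exists u, v; apply: val_inj. Qed.

(* The numbers [ns] in unary, with [true] as digit and [false] as terminator. *)
Definition unary (m : nat) : seq bool := rcons (nseq m true) false.
Definition unaries (ns : seq nat) : seq bool := flatten (map unary ns).

Lemma unaries_cat ms ns : unaries (ms ++ ns) = unaries ms ++ unaries ns.
Proof. by rewrite /unaries map_cat flatten_cat. Qed.

Lemma unary_cat_inj m n u v : unary m ++ u = unary n ++ v -> m = n /\ u = v.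
Proof.
elim: m n => [|m IHm] [|n] //=; first by case.
by case=> /IHm[-> ->].
Qed.

Lemma unaries_inj : injective unaries.
Proof.
elim=> [|m ms IHm] [|n ns] //=; rewrite /unaries /=.
- by case: n.
- by case: m.
- by move/unary_cat_inj=> [-> /IHm ->].
Qed.

Section Copier.
Variable x : nat.

(* The pairs [(X, Y)] with [X = unaries (0 :: x :: nseq j 0 ++ [:: n]) ++ Y]:
   the states [8 + x], ..., 7 read the first two numbers, state 5 the zeros
   and state 6 the last number, after which the states 0, ..., 4 compare the rest
   of tape 0 with tape 1. *)
Definition copier_tape (q : nat) : 'I_2 :=
  if q \in [:: 1; 2; 3] then tape1 else tape0.

(** State [7 + k] expects the unary number [k], except that the initial state [8 + x] expects the
    number 0, a lone terminator. On a terminator, state 5 guesses whether the last number, then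
    equal to 0, has just been read. Successors are listed in increasing order, as in the Gödel
    number. *)
Definition copier_delta (q : nat) (s : option bool) : seq nat :=
  match q, s with
  | 0, Some true => [:: 1]
  | 0, Some false => [:: 2]
  | 0, None => [:: 3]
  | 1, Some true => [:: 0]
  | 2, Some false => [:: 0]
  | 3, None => [:: 4]
  | 5, Some true => [:: 6]
  | 5, Some false => [:: 0; 5]
  | 6, Some true => [:: 6]
  | 6, Some false => [:: 0]
  | 7, Some false => [:: 5]
  | k.+4.+4, Some true => if k == x then [::] else [:: 7 + k]
  | k.+4.+4, Some false => if k == x then [:: 7 + x] else [::]
  | _, _ => [::]
  end.

Definition copier : automaton bool 2 :=
  {| state := 'I_(9 + x);
     tape_of := fun q => copier_tape q;
     delta := fun q s => [set q' : 'I_(9 + x) | (q' : nat) \in copier_delta q s];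
     initial := [set q : 'I_(9 + x) | (q : nat) \in [:: 8 + x]];
     accepting := [set q : 'I_(9 + x) | (q : nat) \in [:: 4]] |}.

Lemma copier_delta_lt q s : q < 9 + x ->
  all (ltn^~ (9 + x)) (copier_delta q s).
Proof.
by move=> qx; do 8?[case: q qx => [|q] qx; first by case: s => [[]|]];
  case: s => [[]|] //=; case: eqP => //=; rewrite ?andbT; lia.
Qed.

Lemma copier_delta_sorted q s : sorted ltn (copier_delta q s).
Proof.
by do 8?[case: q => [|q]; first by case: s => [[]|]];
  case: s => [[]|] //=; case: eqP.
Qed.

(** Acceptance stated on the number of a state, so that no bound on it has to be carried around. *)
Definition cacc (q : nat) u v :=
  exists2 q' : 'I_(9 + x), q' = q :> nat & acc (A := copier) (q', [tuple u; v]).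

Lemma cacc_init u v : cacc 4 u v.
Proof.
have h : 4 < 9 + x by lia.
by exists (Ordinal h) => //; apply/accE; left; rewrite inE.
Qed.

Lemma cacc_read0 q u v : q < 9 + x -> q != 4 -> copier_tape q = tape0 ->
  cacc q u v <-> exists s u', u = s :: u' /\
    exists2 q', q' \in copier_delta q s & cacc q' u' v.
Proof.
move=> hq q4 tq; split.
  case=> p pq /accE[|]; first by rewrite !inE pq (negPf q4).
  case=> s [u' [q' [/=]]]; rewrite pq tq inE put0 => hu hq' ha.
  by exists s, u'; split=> //; exists q' => //; exists q'.
case=> s [u' [-> [q' hd [p pq ha]]]]; exists (Ordinal hq) => //.
apply/accE; right; exists s, u', p.
by rewrite /= tq inE pq put0.
Qed.

Lemma cacc_read1 q u v : q < 9 + x -> q != 4 -> copier_tape q = tape1 ->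
  cacc q u v <-> exists s v', v = s :: v' /\
    exists2 q', q' \in copier_delta q s & cacc q' u v'.
Proof.
move=> hq q4 tq; split.
  case=> p pq /accE[|]; first by rewrite !inE pq (negPf q4).
  case=> s [u' [q' [/=]]]; rewrite pq tq inE put1 => hu hq' ha.
  by exists s, u'; split=> //; exists q' => //; exists q'.
case=> s [u' [-> [q' hd [p pq ha]]]]; exists (Ordinal hq) => //.
apply/accE; right; exists s, u', p.
by rewrite /= tq inE pq put1.
Qed.

Lemma cacc_em q X v : q < 9 + x -> q != 4 -> copier_tape q = tape0 ->
  cacc q (end_marked X) v <->
  match X with
  | [::] => exists2 q', q' \in copier_delta q None & cacc q' [::] v
  | b :: X' => exists2 q', q' \in copier_delta q (Some b) & cacc q' (end_marked X') v
  end.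
Proof.
move=> h1 h2 h3; rewrite cacc_read0 //; case: X => [|b X].
  by split=> [[s [u' [[<- <-]]]]//|h]; exists None, [::].
by split=> [[s [u' [[<- <-]]]]//|h]; exists (Some b), (end_marked X).
Qed.

Lemma cacc12 b u v : cacc (if b then 1 else 2) u v <->
  exists2 v', v = Some b :: v' & cacc 0 u v'.
Proof.
rewrite cacc_read1; try by case: b.
split=> [[s [v' [-> [q']]]]|[v' -> hc]]; last first.
  by exists (Some b), v'; split=> //; exists 0 => //; case: (b).
by case: b; case: s => [[]|] //; rewrite inE => /eqP->; exists v'.
Qed.

Lemma cacc0 X Y : cacc 0 (end_marked X) (end_marked Y) <-> X = Y.
Proof.
elim: X Y => [|b X IHX] Y; rewrite cacc_em //.
  split=> [[q' /=]|<-].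
    rewrite inE => /eqP->; rewrite cacc_read1 //; case: Y => // b Y.
    by case=> s [v' [[<- _] [q2]]].
  exists 3 => //; rewrite cacc_read1 //; exists None, [::]; split=> //.
  by exists 4 => //; apply: cacc_init.
split=> [[q' hq hc]|<-]; last first.
  exists (if b then 1 else 2); first by case: (b).
  by apply/cacc12; exists (end_marked X) => //; apply/IHX.
have eq' : q' = if b then 1 else 2 by move: hq; case: (b); rewrite inE => /eqP.
move: hc; rewrite eq' cacc12 => -[v' + hc].
by case: Y => [//|b' Y] [-> e]; move: hc; rewrite -e => /IHX->.
Qed.

Lemma cacc6 X Y : cacc 6 (end_marked X) (end_marked Y) <->
  exists n, X = unary n ++ Y.
Proof.
elim: X => [|b X IHX]; rewrite cacc_em //.
  by split=> [[]//|[[|n]]].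
case: b => /=.
  split=> [[q']|[[|n] // [eX]]]; last first.
    by exists 6 => //; apply/IHX; exists n.
  by rewrite inE => /eqP-> /IHX[n ->]; exists n.+1.
split=> [[q']|[[|n] // [->]]]; last by exists 0 => //; apply/cacc0.
by rewrite inE => /eqP-> /cacc0->; exists 0.
Qed.

Lemma cacc5 X Y : cacc 5 (end_marked X) (end_marked Y) <->
  exists j n, X = unaries (rcons (nseq j 0) n) ++ Y.
Proof.
have unE n Z : unaries [:: n] ++ Z = unary n ++ Z by rewrite /unaries /= cats0.
elim: X => [|b X IHX]; rewrite cacc_em //.
  by split=> [[]//|[[|j] [[|n]]]].
case: b => /=.
  split=> [[q']|[[|j] [n]]] //.
    by rewrite inE => /eqP-> /cacc6[n ->]; exists 0, n.+1; rewrite unE.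
  rewrite unE; case: n => // n [eX].
  by exists 6 => //; apply/cacc6; exists n.
split=> [[q']|[[|j] [n]]].
- rewrite !inE => /orP[]/eqP->.
    by move/cacc0=> ->; exists 0, 0.
  by move/IHX=> [j [n ->]]; exists j.+1, n.
- rewrite unE; case: n => // [[->]].
  by exists 0 => //; apply/cacc0.
- by case=> eX; exists 5 => //; apply/IHX; exists j, n.
Qed.

Lemma cacc_chain k X Y : k <= x -> cacc (7 + k) (end_marked X) (end_marked Y) <->
  exists j n, X = unaries (k :: rcons (nseq j 0) n) ++ Y.
Proof.
elim: k X => [|k IHk] X kx; rewrite cacc_em //; try by lia.
  case: X => [|[] X].
  - by split=> [[]//|[j [n]]].
  - by split=> [[]//|[j [n]]].
  split=> [[q']|[j [n [eX]]]].
    by rewrite inE => /eqP-> /cacc5[j [n ->]]; exists j, n.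
  by exists 5 => //; apply/cacc5; exists j, n.
case: X => [|b X].
  by split=> [[]//|[j [n]]].
rewrite /= (ltn_eqF kx); case: b => /=; last by split=> [[]|[j [n]]].
split=> [[q']|[j [n [eX]]]].
  by rewrite inE => /eqP-> /(IHk _ (ltnW kx))[j [n ->]]; exists j, n.
by exists (7 + k); [rewrite inE|apply/IHk; [apply: ltnW|exists j, n]].
Qed.

Lemma copier_lang X Y : lang copier [tuple X; Y] <->
  exists j n, X = unaries [:: 0, x & rcons (nseq j 0) n] ++ Y.
Proof.
have -> : lang copier [tuple X; Y] <-> cacc (8 + x) (end_marked X) (end_marked Y).
  rewrite langE; split=> [[q0]|[q0 hq ha]].
    by rewrite inE mem_seq1 => /eqP hq ha; exists q0; rewrite // -map_tuple2.
  by exists q0; rewrite ?inE ?hq // /start map_tuple2.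
rewrite cacc_em //; case: X => [|[] X] /=; rewrite ?eqxx.
- by split=> [[]//|[j [n]]].
- by split=> [[]//|[j [n]]].
split=> [[q']|[j [n [eX]]]].
  by rewrite inE => /eqP-> /(cacc_chain _ _ (leqnn x))[j [n ->]]; exists j, n.
by exists (7 + x); [rewrite inE|apply/cacc_chain => //; exists j, n].
Qed.

(** Ranks in ['I_m] are the values, and two strictly increasing lists with the same members are
    equal. *)
Lemma code_set_ord m (l : seq nat) : sorted ltn l -> all (ltn^~ m) l ->
  code_set [set q : 'I_m | (q : nat) \in l] = CodeSeq.code l.
Proof.
move=> hs hl; rewrite /code_set; congr CodeSeq.code.
rewrite /image_mem (eq_map (g := val)) => [|q]; last by rewrite enum_rank_ord.
apply: (irr_sorted_eq ltn_trans ltnn) => //.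
  apply: (subseq_sorted ltn_trans (s2 := iota 0 m)); last exact: iota_ltn_sorted.
  by rewrite -val_enum_ord; apply/map_subseq; rewrite enumT; apply: filter_subseq.
move=> i; apply/mapP/idP => [[q]|hi]; first by rewrite mem_enum inE => hq ->.
by exists (Ordinal (allP hl i hi)); rewrite ?mem_enum ?inE.
Qed.

Lemma map_val_ord m (T : Type) (f : nat -> T) :
  [seq f q | q : 'I_m] = [seq f q | q <- iota 0 m].
Proof. by rewrite -val_enum_ord -map_comp. Qed.

Lemma enum_option_bool : enum {: option bool} = [:: None; Some true; Some false].
Proof. by rewrite /enum_mem unlock /= unlock. Qed.

Lemma eq_code5 a1 b1 c1 d1 e1 a2 b2 c2 d2 e2 :
  a1 = a2 -> b1 = b2 -> c1 = c2 -> d1 = d2 -> e1 = e2 ->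
  CodeSeq.code [:: a1; b1; c1; d1; e1] = CodeSeq.code [:: a2; b2; c2; d2; e2].
Proof. by do 5!move=> ->. Qed.

Definition copier_row (q : nat) : nat :=
  CodeSeq.code [seq CodeSeq.code (copier_delta q s)
               | s <- [:: None; Some true; Some false]].

Lemma copier_code : code_automaton copier = CodeSeq.code
  [:: 9 + x;
      CodeSeq.code [seq nat_of_ord (copier_tape q) | q <- iota 0 (9 + x)];
      CodeSeq.code [seq copier_row q | q <- iota 0 (9 + x)];
      CodeSeq.code [:: 8 + x]; CodeSeq.code [:: 4]].
Proof.
rewrite /code_automaton; apply: eq_code5.
- exact: card_ord.
- congr CodeSeq.code; exact: (map_val_ord _ (fun q => nat_of_ord (copier_tape q))).
- congr CodeSeq.code; rewrite -map_val_ord; apply: eq_map => q.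
  rewrite /copier_row; congr CodeSeq.code.
  rewrite /image_mem enum_option_bool; apply: eq_map => s.
  exact: code_set_ord (copier_delta_sorted _ _) (copier_delta_lt _ (ltn_ord _)).
- by apply: code_set_ord; rewrite //= andbT; lia.
- exact: code_set_ord.
Qed.

End Copier.

(** * Primitive recursive terms for Gödel numbers *)

Definition add (n : nat) (t : term) : term := iter n Suc t.
Definition num (n : nat) : term := add n Zero.
Definition double (t : term) : term := Rec t Zero (add 2 (Var 0)).
(** The successor of twice [u], doubled [t] times: this is [code_cons] below. *)
Definition consT (t u : term) : term :=
  Rec t (Suc (double u)) (double (Var 0)).
Definition catT (ts : seq term) (u : term) : term := foldr consT u ts.
Definition listT (ts : seq term) : term := catT ts Zero.

(** [CodeSeq.code] is the right fold of this function from 0, so [Zero] codes the empty list. *)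
Definition code_cons (n m : nat) : nat := 2 ^ n * m.*2.+1.

Lemma eval_add n t env : eval (add n t) env = n + eval t env.
Proof. by elim: n => //= n ->. Qed.

Lemma eval_num n env : eval (num n) env = n.
Proof. by rewrite eval_add addn0. Qed.

Lemma eval_double t env : eval (double t) env = (eval t env).*2.
Proof.
have downtoE n m : downto n (fun _ acc => acc.+2) m = n.*2 + m.
  by elim: n m => //= n IHn m; rewrite IHn; lia.
by rewrite /= downtoE addn0.
Qed.

Lemma eq_downto f g n b : f =2 g -> downto n f b = downto n g b.
Proof. by move=> fg; elim: n b => //= n IHn b; rewrite fg IHn. Qed.

Lemma eval_Rec n b s env : eval (Rec n b s) env =
  downto (eval n env) (fun k acc => eval s [:: acc, k & env]) (eval b env).
Proof. by []. Qed.

Lemma eval_cons t u env :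
  eval (consT t u) env = code_cons (eval t env) (eval u env).
Proof.
rewrite eval_Rec (@eq_downto _ (fun _ acc => acc.*2)) => [|k acc]; last first.
  exact: eval_double.
rewrite /code_cons -eval_double -[eval (Suc _) _]/(_.+1).
move: (_.+1) (eval t env) => m n; elim: n m => [|n IHn] m; first by rewrite mul1n.
by rewrite [LHS]IHn expnSr -mul2n mulnA.
Qed.

Lemma eval_cat ts u env : eval (catT ts u) env =
  foldr code_cons (eval u env) [seq eval t env | t <- ts].
Proof. by elim: ts => // t ts IHts; rewrite [LHS]eval_cons IHts. Qed.

Lemma eval_list ts env :
  eval (listT ts) env = CodeSeq.code [seq eval t env | t <- ts].
Proof. exact: eval_cat. Qed.

Lemma code_cat l l' :
  CodeSeq.code (l ++ l') = foldr code_cons (CodeSeq.code l') l.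
Proof. exact: foldr_cat. Qed.

(** As the index goes down, consing at each turn builds the list in increasing order. *)
Lemma downto_code f n b : downto n (fun k acc => code_cons (f k) acc) b =
  foldr code_cons b [seq f k | k <- iota 0 n].
Proof.
elim: n b => // n IHn b.
by rewrite [LHS]IHn -[in RHS]addn1 iotaD map_cat foldr_cat.
Qed.

(** Used for the states below 8, whose transitions are the same for all [x]; hence the parameter
    0. *)
Definition read_row (q : nat) : seq term :=
  [seq listT [seq num q' | q' <- copier_delta 0 q s]
  | s <- [:: None; Some true; Some false]].

Definition tapes_term : term :=
  catT [seq num (copier_tape q) | q <- iota 0 8]
    (Rec (Var 0) (listT [:: Zero]) (consT Zero (Var 0))).

(** The loop conses the rows of the states [8 + k] for [k < x] in front of the row of the initial
    state [8 + x], the only one of these states that moves on a terminator. *)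
Definition rows_term : term :=
  catT [seq listT (read_row q) | q <- iota 0 8]
    (Rec (Var 0)
      (listT [:: listT [:: Zero; Zero; listT [:: add 7 (Var 0)]]])
      (consT (listT [:: Zero; listT [:: add 7 (Var 1)]; Zero]) (Var 0))).

(* The code of the instance made of the copier for [x] and an automaton of code
   [x], as a function of [x]. *)
Definition instance_term : term :=
  listT [:: num 2; num 2; num 2; Var 0;
    listT [:: add 9 (Var 0); tapes_term; rows_term;
              listT [:: add 8 (Var 0)]; listT [:: num 4]]].

Lemma closed_instance_term : closed 1 instance_term.
Proof. by vm_compute. Qed.

Lemma eval_loop F n b s env :
  (forall k acc, eval s [:: acc, k & env] = F k) ->
  eval (Rec n b (consT s (Var 0))) env =
  foldr code_cons (eval b env) [seq F k | k <- iota 0 (eval n env)].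
Proof.
move=> hF; rewrite eval_Rec -downto_code; apply: eq_downto => k acc.
by rewrite eval_cons hF.
Qed.

Lemma eval_tapes_term x : eval tapes_term [:: x] =
  CodeSeq.code [seq nat_of_ord (copier_tape q) | q <- iota 0 (9 + x)].
Proof.
rewrite /tapes_term.
have -> : 9 + x = 8 + (x + 1) by lia.
rewrite iotaD iotaD !map_cat !code_cat eval_cat -map_comp.
rewrite (eq_map (g := fun q => nat_of_ord (copier_tape q))) => [|q]; last first.
  exact: eval_num.
congr foldr; rewrite (@eval_loop (fun=> 0)) // eval_list.
congr foldr; rewrite -[0 + 8]/(8 + 0) iotaDl -map_comp.
by apply: eq_map.
Qed.

Lemma eval_row3 t1 t2 t3 env : eval (listT [:: t1; t2; t3]) env =
  CodeSeq.code [:: eval t1 env; eval t2 env; eval t3 env].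
Proof. exact: eval_list. Qed.

Lemma eval_row ls env : eval (listT [seq listT [seq num q | q <- l] | l <- ls]) env =
  CodeSeq.code [seq CodeSeq.code l | l <- ls].
Proof.
rewrite eval_list -map_comp; congr CodeSeq.code; apply: eq_map => l /=.
rewrite eval_list -map_comp (eq_map (g := id)) ?map_id // => q; exact: eval_num.
Qed.

Lemma eval_rows_term x : eval rows_term [:: x] =
  CodeSeq.code [seq copier_row x q | q <- iota 0 (9 + x)].
Proof.
rewrite /rows_term.
have -> : 9 + x = 8 + (x + 1) by lia.
rewrite iotaD iotaD !map_cat !code_cat eval_cat -map_comp.
pose mid k := CodeSeq.code [:: 0; CodeSeq.code [:: 7 + k]; 0].
rewrite (@eval_loop mid) => [|k acc]; last by rewrite eval_row3 eval_list.
have -> : [seq mid k | k <- iota 0 (eval (Var 0) [:: x])] =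
    [seq copier_row x q | q <- iota (0 + 8) x].
  rewrite -[0 + 8]/(8 + 0) iotaDl -map_comp; apply/eq_in_map => k.
  by rewrite mem_iota add0n => /andP[_ kx]; rewrite /= /copier_row /= (ltn_eqF kx).
have -> : eval (listT [:: listT [:: Zero; Zero; listT [:: add 7 (Var 0)]]]) [:: x] =
    CodeSeq.code [seq copier_row x q | q <- iota (0 + 8 + x) 1].
  rewrite eval_list /map eval_row3 eval_list /map eval_add.
  by rewrite /copier_row /= eqxx.
apply: (congr1 (foldr _ _)); apply/eq_in_map => q; rewrite mem_iota => /andP[_ q8].
rewrite -[LHS]/(eval (listT (read_row q)) [:: x]) /read_row.
have := eval_row
  [seq copier_delta 0 q s | s <- [:: None; Some true; Some false]] [:: x].
rewrite -!map_comp => ->; apply: (congr1 CodeSeq.code); apply: eq_map => s /=.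
by move: q8; do 8!case: q => [|q] //.
Qed.

(** The automaton [A] enters the code of the instance only through its own code [x], which is also
    the parameter of the copier. The instance is thus computable from [x] alone, which makes the
    diagonal argument possible. *)
Lemma code_instance_copier (A : automaton bool 2) :
  let x := code_automaton A in
  code_instance (@Instance _ 2 2 isT (leqnn 2) A (copier x)) =
  eval instance_term [:: x].
Proof.
move=> x; rewrite /instance_term eval_list /map eval_list /code_instance.
apply: eq_code5; rewrite ?eval_num //; first exact: card_bool.
rewrite copier_code /map eval_tapes_term eval_rows_term !eval_list.
by apply: eq_code5; rewrite ?eval_add.
Qed.

(** * Automata from regular expressions *)

Inductive regexp (T : Type) :=
  | Void | Eps | Chr of T
  | Alt of regexp T & regexp T | Cat of regexp T & regexp T | Star of regexp T.
Arguments Void {T}.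
Arguments Eps {T}.

Section RegexpChoice.
Variable T : choiceType.

(** Trees give regular expressions a choice structure, so that the members of a list of them form a
    finite type of states. *)
Fixpoint tree_of_regexp (e : regexp T) : GenTree.tree T :=
  match e with
  | Void => GenTree.Node 0 [::]
  | Eps => GenTree.Node 1 [::]
  | Chr a => GenTree.Leaf a
  | Alt e f => GenTree.Node 2 [:: tree_of_regexp e; tree_of_regexp f]
  | Cat e f => GenTree.Node 3 [:: tree_of_regexp e; tree_of_regexp f]
  | Star e => GenTree.Node 4 [:: tree_of_regexp e]
  end.

Fixpoint regexp_of_tree (t : GenTree.tree T) : regexp T :=
  match t with
  | GenTree.Leaf a => Chr a
  | GenTree.Node 1 _ => Eps
  | GenTree.Node 2 [:: t; u] => Alt (regexp_of_tree t) (regexp_of_tree u)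
  | GenTree.Node 3 [:: t; u] => Cat (regexp_of_tree t) (regexp_of_tree u)
  | GenTree.Node 4 [:: t] => Star (regexp_of_tree t)
  | _ => Void
  end.

Lemma tree_of_regexpK : cancel tree_of_regexp regexp_of_tree.
Proof. by elim=> //= [e -> f ->|e -> f ->|e ->]. Qed.

HB.instance Definition _ := Choice.copy (regexp T) (can_type tree_of_regexpK).

End RegexpChoice.

Section Regexp.
Variable T : choiceType.
Implicit Types (e f : regexp T) (a : T) (w : seq T).

Fixpoint matches e w : Prop :=
  match e with
  | Void => False
  | Eps => w = [::]
  | Chr a => w = [:: a]
  | Alt e f => matches e w \/ matches f w
  | Cat e f => exists u v, [/\ w = u ++ v, matches e u & matches f v]
  | Star e => exists2 ws, w = flatten ws & forall u, u \in ws -> matches e u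
  end.

Fixpoint nullable e : bool :=
  match e with
  | Void | Chr _ => false
  | Eps | Star _ => true
  | Alt e f => nullable e || nullable f
  | Cat e f => nullable e && nullable f
  end.

(* Antimirov's linear form: the pairs [(a, e')] such that [a] followed by a word
   of [e'] is a word of [e]. *)
Fixpoint linear_form e : seq (T * regexp T) :=
  match e with
  | Void | Eps => [::]
  | Chr a => [:: (a, Eps)]
  | Alt e f => linear_form e ++ linear_form f
  | Cat e f => [seq (p.1, Cat p.2 f) | p <- linear_form e] ++
               if nullable e then linear_form f else [::]
  | Star e => [seq (p.1, Cat p.2 (Star e)) | p <- linear_form e]
  end.

(** Antimirov's partial derivatives, each with the letter that leads to it. Unlike in [linear_form],
    the second factor of a [Cat] always contributes, which makes this finite list closed under
    taking linear forms. *)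
Fixpoint derivatives e : seq (T * regexp T) :=
  match e with
  | Void | Eps => [::]
  | Chr a => [:: (a, Eps)]
  | Alt e f => derivatives e ++ derivatives f
  | Cat e f => [seq (p.1, Cat p.2 f) | p <- derivatives e] ++ derivatives f
  | Star e => [seq (p.1, Cat p.2 (Star e)) | p <- derivatives e]
  end.

Lemma nullableP e : nullable e <-> matches e [::].
Proof.
elim: e => //= [e IHe f IHf|e IHe f IHf|e _].
- by rewrite -IHe -IHf; split=> /orP.
- split=> [/andP[/IHe he /IHf hf]|[u [v [hw he hf]]]]; first by exists [::], [::].
  by case: u v hw he hf => [|//] [|//] _ /IHe-> /IHf->.
- by split=> // _; exists [::].
Qed.

Lemma linear_formP e a w :
  matches e (a :: w) <-> exists2 e', (a, e') \in linear_form e & matches e' w.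
Proof.
elim: e a w => [||b|e IHe f IHf|e IHe f IHf|e IHe] a w /=.
- by split=> [|[]].
- by split=> [|[]].
- split=> [[-> ->]|[e']]; first by exists Eps; rewrite ?inE.
  by rewrite inE => /eqP[-> ->] /= ->.
- rewrite IHe IHf; split.
    by case=> -[e' h1 h2]; exists e' => //; rewrite mem_cat h1 ?orbT.
  case=> e'; rewrite mem_cat => /orP[h|h] hm; by [left; exists e'|right; exists e'].
- split=> [[[|b u] [v [/= hw he hf]]]|[e']].
  + move/nullableP: he => he; rewrite -hw IHf in hf; case: hf => e' h1 h2.
    by exists e' => //; rewrite mem_cat he h1 orbT.
  + case: hw he => <- -> /IHe[e' h1 h2]; exists (Cat e' f); last by exists u, v.
    by rewrite mem_cat; apply/orP; left; apply/mapP; exists (a, e').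
  + rewrite mem_cat => /orP[/mapP[[b e1] he [-> ->]] /= [u [v [-> h1 h2]]]|].
      by exists (b :: u), v; split=> //; apply/IHe; exists e1.
    case: ifP => // /nullableP he hf hm; exists [::], (a :: w); split=> //.
    by apply/IHf; exists e'.
- split=> [[ws]|[e' /mapP[[b e1] he [-> ->]] /= [u [v [-> h1 [ws -> h2]]]]]].
    (* Empty factors are skipped until the one that provides the letter [a]. *)
    elim: ws => //= -[|b u] ws IHws hw hm.
      by apply: IHws => // u hu; apply: hm; rewrite inE hu orbT.
    case: hw hm => <- -> hm.
    have /IHe[e' h1 h2] : matches e (a :: u) by apply: hm; rewrite inE eqxx.
    exists (Cat e' (Star e)); first by apply/mapP; exists (a, e').
    exists u, (flatten ws); split=> //; exists ws => // v hv.
    by apply: hm; rewrite inE hv orbT.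
  exists ((b :: u) :: ws) => // u'; rewrite inE => /orP[/eqP->|/h2//].
  by apply/IHe; exists e1.
Qed.

Lemma linear_form_derivatives e : {subset linear_form e <= derivatives e}.
Proof.
elim: e => //= [b|e IHe f IHf|e IHe f IHf|e IHe] p //.
- by rewrite !mem_cat => /orP[/IHe->|/IHf->]; rewrite ?orbT.
- rewrite !mem_cat => /orP[/mapP[q /IHe hq ->]|].
    by rewrite (map_f (fun p => (p.1, Cat p.2 f)) hq).
  by case: ifP => // _ /IHf->; rewrite orbT.
- by case/mapP=> q /IHe hq ->; rewrite (map_f (fun p => (p.1, Cat p.2 (Star e))) hq).
Qed.

Lemma derivatives_closed e p :
  p \in derivatives e -> {subset linear_form p.2 <= derivatives e}.
Proof.
elim: e p => //= [b|e IHe f IHf|e IHe f IHf|e IHe] p.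
- by rewrite inE => /eqP-> q.
- by rewrite mem_cat => /orP[/IHe|/IHf] h q /h hq; rewrite mem_cat hq ?orbT.
- rewrite mem_cat => /orP[/mapP[[a e'] he ->]|/IHf h] q /=; last first.
    by move/h => hq; rewrite mem_cat hq orbT.
  rewrite !mem_cat => /orP[/mapP[r /(IHe _ he) hr ->]|].
    by rewrite (map_f (fun p => (p.1, Cat p.2 f)) hr).
  by case: ifP => // _ /linear_form_derivatives->; rewrite orbT.
- case/mapP=> -[a e'] he -> q /=.
  rewrite mem_cat => /orP[/mapP[r /(IHe _ he) hr ->]|].
    by rewrite (map_f (fun p => (p.1, Cat p.2 (Star e))) hr).
  case: ifP => // _ /mapP[r /linear_form_derivatives hr ->].
  by rewrite (map_f (fun p => (p.1, Cat p.2 (Star e))) hr).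
Qed.

End Regexp.

(* A regular expression over the actions [(t, s)], "read [s] on tape [t]",
   denotes the tuples that extend the projections to the tapes of some word. *)
Section RegexpAutomaton.
Variables (Sigma : finType) (n : nat).
Notation action := ('I_n.+1 * option Sigma)%type.

Definition proj (t : 'I_n.+1) (w : seq action) : seq (option Sigma) :=
  [seq a.2 | a <- w & a.1 == t].

Variable e : regexp action.

(** [None] stands for the end of the word and is reachable exactly when nothing more has to be
    read. *)
Definition successors (e' : regexp action) : {set option (seq_sub (derivatives e))} :=
  [set p | if p is Some p then val p \in linear_form e' else nullable e'].

(* A state holds the action to perform next and what must follow it. *)
Definition regexp_automaton : automaton Sigma n.+1 :=
  {| state := option (seq_sub (derivatives e));
     tape_of := fun q => if q is Some p then (val p).1.1 else ord0;
     delta := fun q s =>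
       if q is Some p then
         if s == (val p).1.2 then successors (val p).2 else set0
       else set0;
     initial := successors e;
     accepting := [set None] |}.

(** The actions performed along an accepting run spell a word of [e'], and such a word dictates a
    run. Prefixes appear because a run may accept before its input is consumed. *)
Lemma acc_successors e' y :
  (forall p, p \in linear_form e' -> p \in derivatives e) ->
  (exists2 q, q \in successors e' & acc (A := regexp_automaton) (q, y)) <->
  (exists2 w, matches e' w & forall t, prefix (proj t w) (tnth y t)).
Proof.
move=> he'; split.
  case=> q hq [run]; elim: run q y e' {he'} hq => [|[q' y'] run IHrun] q y e' hq /=.
    by move=> _; rewrite inE => /eqP qN; move: hq; rewrite qN inE => /nullableP hn;
      exists [::] => // t; apply: prefix0s.
  case/andP; rewrite /move /=; case E: (tnth _ _) => [|s v] // /andP[].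
  case: q hq E => [p|] /=; last by rewrite !inE.
  rewrite inE => hp E.
  case: eqP => [es|]; last by rewrite inE.
  move=> hq' /eqP-> hpath hacc.
  have [w hw1 hw2] := IHrun _ _ _ hq' hpath hacc.
  move: p hp E es hw1 hw2 {hq' hpath hacc} => [[[t s'] e1] /= hd] hp E es hw1 hw2.
  exists ((t, s') :: w); first by apply/linear_formP; exists e1.
  move=> t'; have := hw2 t'; rewrite tnth_mktuple /= /proj /= eq_sym.
  by case: eqP => [<-|//]; rewrite /= E /= -es eqxx.
case=> w; elim: w y e' he' => [|[t s] w IHw] y e' he' hm hy.
  exists None; first by rewrite inE; apply/nullableP.
  by apply/accE; left; rewrite inE.
case/linear_formP: hm => e1 he1 hm; have hd := he' _ he1.
have [v tv] : exists v, tnth y t = s :: v.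
  have := hy t; rewrite /proj /= eqxx /=; case: (tnth y t) => //= s' v.
  by case/andP=> /eqP<- _; exists v.
have [||q hq1 hq2] := IHw (put y t v) e1 _ hm.
- by move=> p; apply: (derivatives_closed hd).
- move=> t'; have := hy t'; rewrite tnth_mktuple /proj /=.
  by case: (eqVneq t t') => // <-; rewrite tv /= eqxx.
exists (Some (SeqSub hd)); first by rewrite inE.
by apply/accE; right; exists s, v, q; split; rewrite //= eqxx.
Qed.

Lemma regexp_automaton_lang x : lang regexp_automaton x <->
  exists2 w, matches e w & forall t, prefix (proj t w) (end_marked (tnth x t)).
Proof.
rewrite langE (acc_successors _ (@linear_form_derivatives _ e)).
by split=> -[w h1 h2]; exists w => // t; have := h2 t; rewrite tnth_map.
Qed.

End RegexpAutomaton.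

(** * Relations between two tapes *)

Notation action := ('I_2 * option bool)%type.

Definition on0 (b : bool) : action := (tape0, Some b).
Definition on1 (b : bool) : action := (tape1, Some b).

Definition word (w : seq action) : regexp action :=
  foldr (fun a e => Cat (Chr a) e) Eps w.

(** The rational relation denoted by [e]: the order in which actions on the two tapes are
    interleaved is forgotten. *)
Definition relates (e : regexp action) (u v : seq (option bool)) : Prop :=
  exists2 w, matches e w & proj tape0 w = u /\ proj tape1 w = v.

Lemma matches_word w w' : matches (word w) w' <-> w' = w.
Proof.
elim: w w' => //= a w IHw w'; split=> [[u [v [-> -> /IHw->]]]//|->].
by exists [:: a], w; split=> //; apply/IHw.
Qed.

Lemma proj_cat (t : 'I_2) (u v : seq action) :
  proj t (u ++ v) = proj t u ++ proj t v.
Proof. by rewrite /proj filter_cat map_cat. Qed.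

Lemma proj_nseq (t : 'I_2) c (a : action) :
  proj t (nseq c a) = nseq (if a.1 == t then c else 0) a.2.
Proof.
elim: c => [|c /= IHc]; rewrite /proj /= ?if_same //.
by case: eqP IHc => //= _ <-.
Qed.

Lemma relates_word w u v :
  relates (word w) u v <-> proj tape0 w = u /\ proj tape1 w = v.
Proof.
split=> [[w' /matches_word-> //]|h].
by exists w => //; apply/matches_word.
Qed.

Lemma relates_cat e f u v : relates (Cat e f) u v <-> exists u1 v1 u2 v2,
  [/\ relates e u1 v1, relates f u2 v2, u = u1 ++ u2 & v = v1 ++ v2].
Proof.
split=> [[_ [w1 [w2 [-> h1 h2]]] [<- <-]]|].
  exists (proj tape0 w1), (proj tape1 w1), (proj tape0 w2), (proj tape1 w2).
  by split; rewrite ?proj_cat; [exists w1|exists w2| |].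
case=> [u1 [v1 [u2 [v2 [[w1 h1 [<- <-]] [w2 h2 [<- <-]] -> ->]]]]].
by exists (w1 ++ w2); [exists w1, w2|rewrite !proj_cat].
Qed.

Lemma relates_eps u v : relates Eps u v <-> u = [::] /\ v = [::].
Proof. by split=> [[w -> [<- <-]]|[-> ->]] //; exists [::]. Qed.

Lemma relates_star e u v : relates (Star e) u v <->
  exists ps : seq (seq (option bool) * seq (option bool)),
  [/\ u = flatten (unzip1 ps), v = flatten (unzip2 ps) &
      forall p, p \in ps -> relates e p.1 p.2].
Proof.
split=> [[_ [ws -> h] [<- <-]]|[ps [-> -> h]]].
  exists [seq (proj tape0 w, proj tape1 w) | w <- ws]; split.
  - by elim: ws {h} => //= w ws IHws; rewrite proj_cat IHws.
  - by elim: ws {h} => //= w ws IHws; rewrite proj_cat IHws.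
  - by move=> p /mapP[w /h hw ->]; exists w.
elim: ps h => [|p ps IHps] h /=; first by exists [::] => //; exists [::].
have [w h1 [<- <-]] := h p (mem_head _ _).
have [q hq|_ [ws -> h2] [<- <-]] := IHps; first by apply: h; rewrite inE hq orbT.
exists (w ++ flatten ws); last by rewrite !proj_cat.
by exists (w :: ws) => // u'; rewrite inE => /orP[/eqP->|/h2].
Qed.

Lemma relates_star_word w u v : relates (Star (word w)) u v <->
  exists c, u = flatten (nseq c (proj tape0 w)) /\ v = flatten (nseq c (proj tape1 w)).
Proof.
rewrite relates_star; split=> [[ps [-> -> h]]|[c [-> ->]]].
  exists (size ps); elim: ps h => //= p ps IHps h.
  have /relates_word[<- <-] := h p (mem_head _ _).
  by have [q hq|-> ->] := IHps; first by apply: h; rewrite inE hq orbT.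
exists (nseq c (proj tape0 w, proj tape1 w)).
split; rewrite /unzip1 /unzip2 ?map_nseq //.
by move=> p /nseqP[-> _]; apply/relates_word.
Qed.

Notation some := (map Some).

Lemma flatten_nseq1 (T : Type) c (a : T) : flatten (nseq c [:: a]) = nseq c a.
Proof. by elim: c => //= c ->. Qed.

Lemma some_unary c i : nseq c (Some true) ++ nseq i (Some true) ++ [:: Some false] =
  some (unary (c + i)).
Proof. by rewrite /unary map_rcons -cats1 map_nseq nseqD catA. Qed.

(* [block (l, i, j)] relates the unary numbers [i] and [j], and also [c + i] and
   [c + j] for all [c] when [l] holds. *)
Notation block_spec := (bool * nat * nat)%type.

Definition block (b : block_spec) : regexp action :=
  let: (l, i, j) := b in
  Cat (if l then Star (word [:: on0 true; on1 true]) else Eps)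
    (word (nseq i (on0 true) ++ on0 false :: nseq j (on1 true) ++ [:: on1 false])).

Definition block_rel (b : block_spec) (m n : nat) : Prop :=
  exists2 c, b.1.1 || (c == 0) & m = c + b.1.2 /\ n = c + b.2.

Lemma relates_block b u v : relates (block b) u v <->
  exists m n, [/\ block_rel b m n, u = some (unary m) & v = some (unary n)].
Proof.
case: b => -[l i] j.
have loopE u1 v1 :
    relates (if l then Star (word [:: on0 true; on1 true]) else Eps) u1 v1 <->
    exists2 c, l || (c == 0) & u1 = nseq c (Some true) /\ v1 = nseq c (Some true).
  case: l.
    rewrite relates_star_word.
    rewrite -[proj tape0 _]/[:: Some true] -[proj tape1 _]/[:: Some true].
    by split=> [[c [-> ->]]|[c _ [-> ->]]]; exists c; rewrite ?flatten_nseq1.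
  rewrite relates_eps; split=> [[-> ->]|[c]]; first by exists 0.
  by move=> /= /eqP->.
have wE :
    let w := nseq i (on0 true) ++ on0 false :: nseq j (on1 true) ++ [:: on1 false] in
    proj tape0 w = nseq i (Some true) ++ [:: Some false] /\
    proj tape1 w = nseq j (Some true) ++ [:: Some false].
  by move=> w; rewrite /w -(cat1s (on0 false)) !proj_cat !proj_nseq.
rewrite relates_cat; split=> [[u1 [v1 [u2 [v2 [/loopE[c hc [-> ->]]]]]]]|].
  case: wE => w0 w1 /relates_word[<- <-] -> ->; rewrite w0 w1 !some_unary.
  by exists (c + i), (c + j); split=> //; exists c.
case=> _ [_ [[c hc [-> ->]] -> ->]].
exists (nseq c (Some true)), (nseq c (Some true)),
  (nseq i (Some true) ++ [:: Some false]), (nseq j (Some true) ++ [:: Some false]).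
by split; rewrite ?some_unary //; [apply/loopE; exists c|apply/relates_word].
Qed.

(* The blocks of a halted configuration, read on tape 0 only. *)
Definition lower_bound_block (i : nat) : regexp action :=
  Cat (Star (word [:: on0 true])) (word (nseq i (on0 true) ++ [:: on0 false])).

Lemma relates_pad u v : relates (Star (word [:: on0 true])) u v <->
  exists c, u = nseq c (Some true) /\ v = [::].
Proof.
have nilE c : flatten (nseq c (proj tape1 [:: on0 true])) = [::] by elim: c.
rewrite relates_star_word -[proj tape0 _]/[:: Some true].
by split=> -[c [-> ->]]; exists c; rewrite flatten_nseq1 nilE.
Qed.

Lemma relates_lower_bound_block i u v : relates (lower_bound_block i) u v <->
  exists m, [/\ i <= m, u = some (unary m) & v = [::]].
Proof.
rewrite relates_cat; split.
  case=> u1 [v1 [u2 [v2 [/relates_pad[c [-> ->]] /relates_word[<- <-] -> ->]]]].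
  by exists (c + i); rewrite leq_addl !proj_cat !proj_nseq some_unary.
case=> m [im -> ->]; exists (nseq (m - i) (Some true)), [::],
  (nseq i (Some true) ++ [:: Some false]), [::].
rewrite some_unary subnK //; split=> //; first by apply/relates_pad; exists (m - i).
by apply/relates_word; rewrite !proj_cat !proj_nseq.
Qed.

Definition catE (es : seq (regexp action)) : regexp action := foldr (@Cat _) Eps es.
Definition altE (es : seq (regexp action)) : regexp action := foldr (@Alt _) Void es.

Fixpoint row_rel (row : seq block_spec) (ms ns : seq nat) : Prop :=
  match row, ms, ns with
  | [::], [::], [::] => True
  | b :: row, m :: ms, n :: ns => block_rel b m n /\ row_rel row ms ns
  | _, _, _ => False
  end.

Lemma relates_row row u v : relates (catE (map block row)) u v <->
  exists ms ns, [/\ row_rel row ms ns, u = some (unaries ms) & v = some (unaries ns)].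
Proof.
elim: row u v => [|b row IHrow] u v.
  rewrite relates_eps; split=> [[-> ->]|[ms [ns [h -> ->]]]].
    by exists [::], [::].
  by case: ms ns h => [|//] [|//].
rewrite relates_cat; split.
  case=> u1 [v1 [u2 [v2 [/relates_block[m [n [hmn -> ->]]]]]]].
  case/IHrow=> ms [ns [h -> ->]] -> ->.
  by exists (m :: ms), (n :: ns); rewrite /unaries /= !map_cat.
case=> -[|m ms] [] // [|n ns] [] // [hmn h] -> ->.
exists (some (unary m)), (some (unary n)), (some (unaries ms)), (some (unaries ns)).
rewrite /unaries /= !map_cat; split=> //; first by apply/relates_block; exists m, n.
by apply/IHrow; exists ms, ns.
Qed.

Lemma relates_lower_bounds ls u v : relates (catE (map lower_bound_block ls)) u v <->
  exists ms, [/\ all2 leq ls ms, u = some (unaries ms) & v = [::]].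
Proof.
elim: ls u v => [|l ls IHls] u v.
  rewrite relates_eps; split=> [[-> ->]|[ms [h -> ->]]]; first by exists [::].
  by case: ms h.
rewrite relates_cat; split.
  case=> u1 [v1 [u2 [v2 [/relates_lower_bound_block[m [lm -> ->]]]]]].
  case/IHls=> ms [h -> ->] -> ->.
  by exists (m :: ms); rewrite /unaries /= map_cat lm.
case=> -[|m ms] [] //= /andP[lm h] -> ->.
exists (some (unary m)), [::], (some (unaries ms)), [::].
rewrite /unaries /= !map_cat; split=> //.
  by apply/relates_lower_bound_block; exists m.
by apply/IHls; exists ms.
Qed.

Definition table_rel (tbl : seq (seq block_spec)) (ms ns : seq nat) : Prop :=
  exists2 row, row \in tbl & row_rel row ms ns.

Definition table_exp (tbl : seq (seq block_spec)) : regexp action :=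
  altE [seq catE (map block row) | row <- tbl].

Lemma relates_table tbl u v : relates (table_exp tbl) u v <->
  exists ms ns, [/\ table_rel tbl ms ns, u = some (unaries ms) & v = some (unaries ns)].
Proof.
have altP row tb : relates (Alt (catE (map block row)) (table_exp tb)) u v <->
    relates (catE (map block row)) u v \/ relates (table_exp tb) u v.
  split=> [[w [] h e]|[] [w h e]]; [left|right|..]; exists w => //; by [left|right].
elim: tbl => [|row tbl IHtbl]; first by split=> [[]//|[ms [ns [[]]]]].
rewrite -[table_exp _]/(Alt (catE (map block row)) (table_exp tbl)) altP IHtbl.
rewrite relates_row; split.
  case=> [] [ms [ns [h -> ->]]]; exists ms, ns; split=> //.
    by exists row => //; apply: mem_head.
  by case: h => row' h1 h2; exists row' => //; rewrite inE h1 orbT.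
case=> ms [ns [[row' + h] -> ->]]; rewrite inE => /orP[/eqP e|h1].
  by left; exists ms, ns; rewrite -e.
by right; exists ms, ns; split=> //; exists row'.
Qed.

(** Reading both end-markers last forces a run to consume both tapes before it accepts. *)
Definition history_exp tbl ls : regexp action :=
  Cat (Star (table_exp tbl))
    (Cat (catE (map lower_bound_block ls)) (word [:: (tape0, None); (tape1, None)])).

Definition history (tbl : seq (seq block_spec)) (ls : seq nat)
    (ps : seq (seq nat * seq nat)) (ms : seq nat) : Prop :=
  (forall p, p \in ps -> table_rel tbl p.1 p.2) /\ all2 leq ls ms.

Lemma history_lang tbl ls X Y :
  lang (regexp_automaton (history_exp tbl ls)) [tuple X; Y] <->
  exists ps ms, [/\ history tbl ls ps ms, X = unaries (flatten (unzip1 ps) ++ ms)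
                  & Y = unaries (flatten (unzip2 ps))].
Proof.
have endP U V : prefix (some U ++ [:: None]) (end_marked V) -> U = V.
  elim: U V => [|a U IHU] [|b V] //=.
  by case: eqP => //= -[->] /IHU->.
have endR V : prefix (some V ++ [:: None]) (end_marked V).
  by rewrite /end_marked -cats1; apply: prefix_refl.
have unf ps : (forall p, p \in ps -> exists ms ns, [/\ table_rel tbl ms ns,
      p.1 = some (unaries ms) & p.2 = some (unaries ns)]) ->
    exists qs, [/\ (forall q, q \in qs -> table_rel tbl q.1 q.2),
      flatten (unzip1 ps) = some (unaries (flatten (unzip1 qs))) &
      flatten (unzip2 ps) = some (unaries (flatten (unzip2 qs)))].
  elim: ps => [|p ps IHps] h; first by exists [::].
  have [ms [ns [h1 h2 h3]]] := h p (mem_head _ _).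
  have [q hq|qs [h4 h5 h6]] := IHps; first by apply: h; rewrite inE hq orbT.
  exists ((ms, ns) :: qs); rewrite /= !unaries_cat !map_cat h2 h3 h5 h6; split=> //.
  by move=> q; rewrite inE => /orP[/eqP->|/h4].
rewrite regexp_automaton_lang; split.
  case=> w hm hp.
  have /relates_cat : relates (history_exp tbl ls) (proj tape0 w) (proj tape1 w).
    by exists w.
  case=> u1 [v1 [u2 [v2 [/relates_star[ps [-> -> hps]] /relates_cat + eu ev]]]].
  case=> u3 [v3 [u4 [v4 [/relates_lower_bounds[ms [hms -> ->]]]]]].
  case/relates_word=> <- <- e2 f2.
  have [p hp'|qs [h1 h2 h3]] := unf ps; first by apply/relates_table/hps.
  exists qs, ms; split=> //; apply/esym/endP.
    have := hp tape0; rewrite eu e2 h2 unaries_cat map_cat -catA; exact.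
  have := hp tape1; rewrite ev f2 h3; exact.
case=> ps [ms [[h1 h2] -> ->]].
have [w hm [hw0 hw1]] : relates (history_exp tbl ls)
    (some (unaries (flatten (unzip1 ps) ++ ms)) ++ [:: None])
    (some (unaries (flatten (unzip2 ps))) ++ [:: None]).
  apply/relates_cat; exists (some (unaries (flatten (unzip1 ps)))),
    (some (unaries (flatten (unzip2 ps)))), (some (unaries ms) ++ [:: None]), [:: None].
  split=> //; last by rewrite unaries_cat map_cat catA.
    apply/relates_star.
    exists [seq (some (unaries p.1), some (unaries p.2)) | p <- ps]; split.
    - by elim: ps {h1} => //= p ps IHps; rewrite unaries_cat map_cat IHps.
    - by elim: ps {h1} => //= p ps IHps; rewrite unaries_cat map_cat IHps.
    - move=> p /mapP[q hq ->]; apply/relates_table.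
      by exists q.1, q.2; split=> //; apply: h1.
  apply/relates_cat; exists (some (unaries ms)), [::], [:: None], [:: None]; split=> //.
    by apply/relates_lower_bounds; exists ms.
  by apply/relates_word.
exists w => // -[[|[|//]] it].
  by rewrite (_ : Ordinal it = tape0) ?hw0; [apply: endR|apply: val_inj].
by rewrite (_ : Ordinal it = tape1) ?hw1; [apply: endR|apply: val_inj].
Qed.

(** * Machine histories *)

Section MachineHistory.
Variables (D : machine) (k : nat).

(** One row per outcome of the instruction. The program counter is a constant block, a register
    block keeps an arbitrary common part, and the test for zero is a register block without that
    part. *)
Definition instr_rows (pc : nat) (ins : instr) : seq (seq block_spec) :=
  match ins with
  | Inc r l =>
      [:: (false, pc, l) :: [seq (true, 0, nat_of_bool (j == r)) | j <- iota 0 k]]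
  | Dec r l l0 =>
      [:: (false, pc, l) :: [seq (true, nat_of_bool (j == r), 0) | j <- iota 0 k];
          (false, pc, l0) :: [seq (j != r, 0, 0) | j <- iota 0 k]]
  end.

Definition machine_table : seq (seq block_spec) :=
  flatten [seq if onth D pc is Some ins then instr_rows pc ins else [::]
          | pc <- iota 0 (size D)].

Definition conf (c : nat * (nat -> nat)) : seq nat := c.1 :: map c.2 (iota 0 k).

Definition halted : seq nat := size D :: nseq k 0.

Lemma row_rel_map (b : nat -> block_spec) (R f : nat -> nat) (P : nat -> Prop) s ns :
  (forall j n, block_rel (b j) (R j) n <-> P j /\ n = f j) ->
  row_rel (map b s) (map R s) ns <-> (forall j, j \in s -> P j) /\ ns = map f s.
Proof.
move=> h; elim: s ns => [|j s IHs] [|n ns] //=.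
- by split=> // -[].
- by split=> // -[].
rewrite h IHs; split.
  case=> [[pj ->] [ps ->]]; split=> // i; rewrite inE => /orP[/eqP->//|/ps //].
case=> ps [-> ->]; split; first by split=> //; apply: ps; rewrite mem_head.
by split=> // i hi; apply: ps; rewrite inE hi orbT.
Qed.

(** The first block forces the row to come from the current instruction, and the tested register
    selects one of the two rows of a [Dec]. Rows exist only for addresses inside the program, so a
    halted configuration has no successor here. *)
Lemma machine_step c ns : reg_bound D < k ->
  table_rel machine_table (conf c) ns <-> c.1 < size D /\ ns = conf (mstep D c).
Proof.
case: c => pc R hk.
have tblE row : row \in machine_table <->
    exists pc' ins, onth D pc' = Some ins /\ row \in instr_rows pc' ins.
  split.
    case/flattenP=> rows /mapP[pc' _ ->].
    by case E: (onth D pc') => [ins|] // h; exists pc', ins.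
  case=> pc' [ins [E h]]; apply/flattenP; exists (instr_rows pc' ins) => //.
  by apply/mapP; exists pc'; rewrite ?E // mem_iota /= -onthTE E.
have constE l n p : block_rel (false, p, l) pc n <-> p = pc /\ n = l.
  split=> [[c /= /eqP->] [-> ->]//|[-> ->]]; by exists 0.
have {tblE}-> : table_rel machine_table (conf (pc, R)) ns <->
    exists2 ins, onth D pc = Some ins &
      exists2 row, row \in instr_rows pc ins & row_rel row (conf (pc, R)) ns.
  split=> [[row /tblE[p [ins [E hrow]]] h]|[ins E [row hrow h]]]; last first.
    by exists row => //; apply/tblE; exists pc, ins.
  suff ep : p = pc by rewrite ep in E hrow; exists ins => //; exists row.
  case: ins {E} hrow => [r l|r l l0]; rewrite !inE.
    by move/eqP=> erow; move: h; rewrite erow; case: ns => // n ns [/constE[]].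
  by case/orP=> /eqP erow; move: h; rewrite erow; case: ns => // n ns [/constE[]].
have incE r j n : block_rel (true, 0, nat_of_bool (j == r)) (R j) n <->
    True /\ n = set_reg R r (R r).+1 j.
  rewrite set_regE; split=> [[c _ /= [hR ->]]|[_ ->]].
    by case: eqP => [<-|_]; rewrite hR !addn0 ?addn1.
  by exists (R j); rewrite //= addn0; case: eqP => [<-|]; rewrite ?addn0 ?addn1.
have decE r j n : block_rel (true, nat_of_bool (j == r), 0) (R j) n <->
    (j = r -> 0 < R j) /\ n = set_reg R r (R r).-1 j.
  rewrite set_regE; split=> [[c _ /= [hR ->]]|[]].
    by case: eqP hR => [<-|?] ->; rewrite !addn0 ?addn1.
  by case: eqP => [<- /(_ erefl) h ->|_ _ ->]; [exists (R j).-1|exists (R j)];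
    rewrite //= ?addn0 // addn1 prednK.
have zeroE r j n : block_rel (j != r, 0, 0) (R j) n <->
    (j = r -> R j = 0) /\ n = R j.
  split=> [[c /= h]|[h ->]].
    rewrite !addn0 => -[-> ->]; split=> // e.
    by move: h; rewrite e eqxx => /eqP.
  exists (R j); rewrite /= ?addn0 //.
  by case: eqP => //= /h->.
rewrite /= -onthTE.
case E: (onth D pc) => [ins|]; last by split=> [[]|[]].
have := reg_boundP E; case: ins E => [r l|r l l0] E /= /leq_ltn_trans /(_ hk) rk.
- split=> [[_ [<-] [row]]|[_ ->]].
    rewrite inE => /eqP->; case: ns => // n ns [/constE[_ ->]].
    by move/(row_rel_map _ _ (incE r)) => [_ ->].
  exists (Inc r l) => //; eexists; first exact: mem_head.
  split; first by apply/constE.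
  by apply/(row_rel_map _ _ (incE r)).
- have rin : r \in iota 0 k by rewrite mem_iota.
  split=> [[_ [<-] [row]]|[_ ->]].
    rewrite !inE => /orP[]/eqP->; case: ns => // n ns [/constE[_ ->]].
      move/(row_rel_map _ _ (decE r)) => [hp ->]; split=> //.
      by have := hp r rin erefl; case: (R r).
    move/(row_rel_map _ _ (zeroE r)) => [hp ->]; split=> //.
    by rewrite (hp r rin erefl).
  exists (Dec r l l0) => //; case Er: (R r) => [|v].
    exists ((false, pc, l0) :: [seq (j != r, 0, 0) | j <- iota 0 k]).
      by rewrite !inE eqxx orbT.
    split; first by apply/constE.
    by apply/(row_rel_map _ _ (zeroE r)); split=> // j _ ->.
  eexists; first exact: mem_head.
  split; first by apply/constE.
  by apply/(row_rel_map _ _ (decE r)); rewrite Er; split=> // j _ ->; rewrite Er.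
Qed.

Lemma table_rel_size ms ns :
  table_rel machine_table ms ns -> size ms = k.+1 /\ size ns = k.+1.
Proof.
case=> row /flattenP[rows /mapP[pc _ ->]].
case: (onth D pc) => [ins|] // hrow.
have -> : k.+1 = size row.
  by case: ins hrow => [r l|r l l0]; rewrite !inE;
    [move/eqP->|case/orP=> /eqP->]; rewrite /= size_map size_iota.
by elim: row ms ns {hrow} => [|b row IHrow] [|m ms] [|n ns] //= [_ /IHrow[-> ->]].
Qed.

Lemma history_size ps ms : history machine_table halted ps ms ->
  size ms = k.+1 /\ size (flatten (unzip1 ps)) = size (flatten (unzip2 ps)).
Proof.
case=> hps hms; split.
  by move: hms; rewrite all2E => /andP[/eqP <- _]; rewrite /= size_nseq.
elim: ps hps => //= p ps IHps h; rewrite !size_cat IHps => [|q hq].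
  by have [-> ->] := table_rel_size (h p (mem_head _ _)).
by apply: h; rewrite inE hq orbT.
Qed.

Lemma size_conf c : size (conf c) = k.+1.
Proof. by rewrite /= size_map size_iota. Qed.

Hypothesis hk : reg_bound D < k.

(* A history whose two tapes differ by the initial configuration [c] is the run
   of the machine from [c]: the second tape is the first one shifted. *)
Lemma history_head c a b ps ms :
  history machine_table halted ((a, b) :: ps) ms ->
  flatten (unzip1 ((a, b) :: ps)) ++ ms = conf c ++ flatten (unzip2 ((a, b) :: ps)) ->
  b = conf (mstep D c) /\
  flatten (unzip1 ps) ++ ms = conf (mstep D c) ++ flatten (unzip2 ps).
Proof.
case=> hps _; rewrite [unzip1 _]/= [unzip2 _]/= ![flatten (_ :: _)]/= => e.
have hab := hps (a, b) (mem_head _ _).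
move/eqP: e; rewrite -catA eqseq_cat; last first.
  by rewrite size_conf (table_rel_size hab).1.
case/andP=> /eqP ea /eqP->; rewrite ea in hab.
by have [_ <-] := (machine_step _ _ hk).1 hab.
Qed.

(** Configurations are peeled off one at a time. When no pair is left, [ms] is the current
    configuration, and its lower bound says that it is halted. *)
Lemma history_halts c ps ms :
  history machine_table halted ps ms ->
  flatten (unzip1 ps) ++ ms = conf c ++ flatten (unzip2 ps) -> halts D c.
Proof.
elim: ps c => [|[a b] ps IHps] c hh e.
  by exists 0; move: hh.2; rewrite -[ms]/([::] ++ ms) e cats0 => /andP[].
have [_ e'] := history_head hh e.
apply/halts_step; apply: IHps e'; split; last exact: hh.2.
by move=> p hp; apply: hh.1; rewrite inE hp orbT.
Qed.

Lemma halts_history c : halts D c -> exists ps ms,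
  history machine_table halted ps ms /\
  flatten (unzip1 ps) ++ ms = conf c ++ flatten (unzip2 ps).
Proof.
case=> t; elim: t c => [|t IHt] c ht.
  exists [::], (conf c); split; last by rewrite cats0.
  have all0 (s : seq nat) : all2 leq (nseq (size s) 0) s by elim: s.
  split=> //=; rewrite ht /=.
  by have := all0 (map c.2 (iota 0 k)); rewrite size_map size_iota.
(* A halted configuration is a fixed point of [mstep], and no pair may start from it. *)
have [ge|lt] := leqP (size D) c.1.
  by apply: IHt; rewrite -(mstep_halted ge) -iterSr.
rewrite iterSr in ht; have [ps [ms [[h1 h2] e]]] := IHt _ ht.
exists ((conf c, conf (mstep D c)) :: ps), ms; split; last by rewrite /= -!catA e.
split=> // p; rewrite inE => /orP[/eqP->|/h1//].
exact/(machine_step _ _ hk).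
Qed.

End MachineHistory.

(** * Non-rationality *)

Section Crossing.
Variables (Sigma : finType) (n : nat) (C : automaton Sigma n).
Notation tapes := (n.-tuple (seq (option Sigma))).
Notation move := (@move Sigma n C).

Definition prepend (P : 'I_n -> seq (option Sigma)) (z : tapes) : tapes :=
  [tuple P k ++ tnth z k | k < n].

Lemma move_read (c c' : config C) : move c c' -> exists P,
  c.2 = prepend P c'.2 /\ forall z, move (c.1, prepend P z) (c'.1, z).
Proof.
case: c c' => q y [q' y']; rewrite /Defs.move /=.
case E: (tnth _ _) => [|s v] // /andP[hq /eqP->].
exists (fun k => if k == tape_of q then [:: s] else [::]); split.
  apply: eq_from_tnth => k; rewrite !tnth_mktuple.
  by case: eqP => [->|].
move=> z; rewrite tnth_mktuple eqxx /= hq; apply/eqP/eq_from_tnth => k.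
by rewrite !tnth_mktuple; case: eqP => [->|].
Qed.

(** A run depends only on the part [P] of the tapes that it reads, so it can be replayed in front of
    any remainder [z]. *)
Lemma run_read (c : config C) run : path move c run -> exists P,
  c.2 = prepend P (last c run).2 /\
  forall z, exists run', path move (c.1, prepend P z) run' /\
    last (c.1, prepend P z) run' = ((last c run).1, z).
Proof.
elim: run c => [|c' run IHrun] c /=.
  have nilE z : prepend (fun=> [::]) z = z.
    by apply: eq_from_tnth => k; rewrite tnth_mktuple.
  move=> _; exists (fun=> [::]); split=> [|z]; first by rewrite nilE.
  by exists [::]; rewrite nilE.
case/andP=> /move_read[P [h1 h2]] /IHrun[P' [h3 h4]].
have catE z : prepend (fun k => P k ++ P' k) z = prepend P (prepend P' z).
  by apply: eq_from_tnth => k; rewrite !tnth_mktuple catA.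
exists (fun k => P k ++ P' k); rewrite catE -h3; split=> // z.
have [run' [h5 h6]] := h4 z; exists ((c'.1, prepend P' z) :: run').
by rewrite catE /= h2 h5.
Qed.

(** A discrete intermediate value property: a move shortens tape [t] by at most one letter. *)
Lemma run_split (c : config C) run t s : path move c run ->
  size (tnth (last c run).2 t) <= s <= size (tnth c.2 t) ->
  exists run1 run2, run = run1 ++ run2 /\ size (tnth (last c run1).2 t) = s.
Proof.
elim: run c => [|c' run IHrun] c /=.
  by move=> _ h; exists [::], [::]; split=> //; apply/eqP; rewrite eqn_leq.
case/andP=> hm hp /andP[h1 h2].
have [e|ne] := eqVneq (size (tnth c.2 t)) s; first by exists [::], (c' :: run).
have [|run1 [run2 [-> e]]] := IHrun c' hp; last by exists (c' :: run1), run2.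
rewrite h1 /=; have {ne}h2 : s < size (tnth c.2 t) by rewrite ltn_neqAle eq_sym ne.
move: hm; rewrite /Defs.move; case E: (tnth _ _) => [|a v] // /andP[_ /eqP->].
rewrite tnth_mktuple; case: eqP h2 => [->|_ /ltnW//].
by rewrite E.
Qed.

Lemma end_marked_cat (x : seq Sigma) P z : end_marked x = P ++ z ->
  z = [::] \/ exists p w : seq Sigma, P = map Some p /\ z = end_marked w.
Proof.
elim: P x => [|a P IHP] [|b x] //=.
- by move=> <-; right; exists [::], [::].
- by move=> <-; right; exists [::], (b :: x).
- by case=> _; case: P {IHP} => //= <-; left.
case=> <- /IHP[|[p [w [-> ->]]]]; first by left.
by right; exists (b :: p), w.
Qed.

Lemma end_marked_inj : injective (@end_marked Sigma).
Proof. by move=> x y /rcons_inj[/(inj_map Some_inj)]. Qed.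

Lemma end_markedD (u v : seq Sigma) : end_marked (u ++ v) = map Some u ++ end_marked v.
Proof. by rewrite /end_marked map_cat rcons_cat. Qed.

(* Either the run never reads past [u] on tape [t], or it crosses the end of [u]
   in a state [q], having read the end-markers of the tapes in [Z]. *)
Definition crossing t (u v : seq Sigma) (d : option (state C * {set 'I_n})) : Prop :=
  match d with
  | None => forall v', exists y, lang C y /\ tnth y t = u ++ v'
  | Some (q, Z) => exists (q0 : state C) P (z : tapes),
      [/\ q0 \in initial C,
          forall k, exists x, end_marked x = P k ++ tnth z k,
          P t = map Some u /\ tnth z t = end_marked v,
          (forall k, (tnth z k == [::]) = (k \in Z)) &
          (forall z', acc (A := C) (q, z') -> acc (A := C) (q0, prepend P z')) /\
          acc (A := C) (q, z)]
  end.

Lemma crossing_exists t u v x : lang C x -> tnth x t = u ++ v ->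
  exists d, crossing t u v d.
Proof.
case=> q0 [run [hq0 hp hacc]] xt.
have [le_s|gt_s] :=
    leqP (size (tnth (last (start q0 x) run).2 t)) (size (end_marked v)).
  (* The run is cut where exactly [v] and its end-marker remain on tape [t]. *)
  have [|run1 [run2 [erun es]]] := run_split hp (t := t) (s := size (end_marked v)).
    by rewrite le_s /= tnth_map xt end_markedD size_cat leq_addl.
  rewrite erun cat_path in hp; rewrite erun last_cat in hacc.
  case/andP: hp => hp1 hp2.
  have [P [h1 h2]] := run_read hp1.
  set c := last _ run1 in es hp2 hacc h1 h2.
  have xP k : end_marked (tnth x k) = P k ++ tnth c.2 k.
    by have := congr1 (fun y => tnth y k) h1; rewrite tnth_map tnth_mktuple.
  exists (Some (c.1, [set k | tnth c.2 k == [::]])); exists q0, P, c.2.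
  split=> //.
  - by move=> k; exists (tnth x k).
  - have /eqP := xP t; rewrite xt end_markedD eqseq_cat => [/andP[/eqP<- /eqP<-]//|].
    apply/eqP; rewrite -(eqn_add2r (size (end_marked v))) -{2}es -!size_cat.
    by rewrite -end_markedD -xt xP.
  - by move=> k; rewrite inE.
  - split; last by exists run2; rewrite -?surjective_pairing.
    move=> z' [run' h3 h4]; have [run'' [h5 h6]] := h2 z'.
    by exists (run'' ++ run'); rewrite ?cat_path ?last_cat h6 ?h5.
(* The run stops inside [u], so what follows [u] on tape [t] can be replaced. *)
exists None => v'.
have [P [h1 h2]] := run_read hp.
set c := last _ run in hacc gt_s h1 h2.
have xP k : end_marked (tnth x k) = P k ++ tnth c.2 k.
  by have := congr1 (fun y => tnth y k) h1; rewrite tnth_map tnth_mktuple.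
have [r ur] : exists r, map Some u = P t ++ r.
  have := xP t; rewrite xt end_markedD => e; exists (drop (size (P t)) (map Some u)).
  have le : size (P t) <= size (map Some u).
    have := congr1 size e; rewrite !size_cat; lia.
  have := congr1 (take (size (P t))) e; rewrite takel_cat // [RHS]take_size_cat //.
  by move=> {1}<-; rewrite cat_take_drop.
pose y := [tuple if k == t then u ++ v' else tnth x k | k < n].
exists y; split; last by rewrite tnth_mktuple eqxx.
pose z : tapes := [tuple if k == t then r ++ end_marked v' else tnth c.2 k | k < n].
apply/langE; exists q0 => //.
have -> : start q0 y = (q0, prepend P z) :> config C.
  congr pair; apply: eq_from_tnth => k; rewrite tnth_map !tnth_mktuple.
  by case: eqP => [->|//]; rewrite end_markedD ur catA.
by have [run' [h3 h4]] := h2 z; exists run' => //; rewrite h4.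
Qed.

(** The first run up to the crossing is continued by the second run from there. Each other tape
    becomes what the first run has read followed by what remains in the second; this is an
    end-marked word because both runs have met the same end-markers. *)
Lemma crossing_mix t u v u' v' d : crossing t u v d -> crossing t u' v' d ->
  exists y, lang C y /\ tnth y t = u ++ v'.
Proof.
case: d => [[q Z]|] /=; last by move=> h _; apply: h.
case=> q0 [P [z [hq0 hx [Pt zt] hZ [hread _]]]].
case=> q0' [P' [z' [_ hx' [_ zt'] hZ' [_ hacc]]]].
have /fin_all_exists[y hy] k : exists y, end_marked y = P k ++ tnth z' k.
  have [x xE] := hx k; have [x' xE'] := hx' k.
  have e : (tnth z k == [::]) = (tnth z' k == [::]) by rewrite hZ hZ'.
  have [z0|[p [w [pE wE]]]] := end_marked_cat xE.
    by exists x; move: e; rewrite xE z0 eqxx => /esym/eqP->.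
  have [z0'|[p' [w' [pE' wE']]]] := end_marked_cat xE'.
    by move: e; rewrite z0' eqxx wE; case: (w).
  by exists (p ++ w'); rewrite pE wE' end_markedD.
exists [tuple y k | k < n]; split; last first.
  by rewrite tnth_mktuple; apply: end_marked_inj; rewrite hy Pt zt' end_markedD.
apply/langE; exists q0 => //.
have -> : start q0 [tuple y k | k < n] = (q0, prepend P z') :> config C.
  by congr pair; apply: eq_from_tnth => k; rewrite tnth_map !tnth_mktuple hy.
exact: hread hacc.
Qed.

(** Pigeonhole: there are finitely many crossing data, so two distinct indices share one and can be
    mixed. *)
Lemma lang_mix t (u : nat -> seq Sigma) (V : nat -> seq Sigma -> Prop) :
  (forall i, exists x v, [/\ lang C x, tnth x t = u i ++ v & V i v]) ->
  exists i j v, [/\ i != j, V j v & exists y, lang C y /\ tnth y t = u i ++ v].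
Proof.
move=> h; pose m := #|{: option (state C * {set 'I_n})}|.
have /fin_all_exists[dv hd] (i : 'I_m.+1) :
    exists dv, crossing t (u i) dv.2 dv.1 /\ V i dv.2.
  have [x [v [hx xt hv]]] := h i.
  by have [d hd] := crossing_exists hx xt; exists (d, v).
have /injectivePn[i [j ij dij]] : ~~ injectiveb (fun i => (dv i).1).
  by apply/negP => /injectiveP/leq_card; rewrite card_ord ltnn.
have [hi _] := hd i; have [hj hV] := hd j; rewrite dij in hi.
by exists (i : nat), (j : nat), (dv j).2; split=> //; apply: crossing_mix hi hj.
Qed.

End Crossing.

(** * The reduction *)

Lemma precompose_gt0 K g M : 0 < size (precompose K g M).
Proof. by rewrite /precompose !size_cat /=; lia. Qed.

Lemma mstep_unused M c r : reg_bound M < r -> (mstep M c).2 r = c.2 r.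
Proof.
case: c => pc R hr /=; case E: (onth M pc) => [ins|//].
have := reg_boundP E; case: ins {E} => [r' l|r' l l0] /= hr'.
  by rewrite set_regE; case: eqP => // e; lia.
by case: (R r') => //= v; rewrite set_regE; case: eqP => // e; lia.
Qed.

Lemma unaries_cat_inj ms ns u v : size ms = size ns ->
  unaries ms ++ u = unaries ns ++ v -> ms = ns /\ u = v.
Proof.
elim: ms ns => [|m ms IHms] [|n ns] //= [/IHms h].
by rewrite /unaries /= -!catA => /unary_cat_inj[-> /h[-> ->]].
Qed.

Section Instance.
Variables (D : machine) (j x : nat).
Hypothesis regD : reg_bound D <= j.
Hypothesis D_gt0 : 0 < size D.

(* The initial registers: the input, [j] zeros, and a register that the machine
   does not use. *)
Definition init (n : nat) : nat -> nat := nth 0 (x :: rcons (nseq j 0) n).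

(** Register 0, the [j] zeros, and register [j.+1], which is beyond those of [D]. *)
Let k := j.+2.

Definition stepper : automaton bool 2 :=
  regexp_automaton (history_exp (machine_table D k) (halted D k)).

Let regDk : reg_bound D < k.
Proof. by rewrite /k; lia. Qed.

Lemma conf_init n : conf k (0, init n) = [:: 0, x & rcons (nseq j 0) n].
Proof.
have sk : size (x :: rcons (nseq j 0) n) = k by rewrite /= size_rcons size_nseq.
by congr cons; rewrite [LHS]map_nth_iota0 ?take_oversize ?sk.
Qed.

Lemma conf_last_reg c d : conf k c = conf k d -> c.2 j.+1 = d.2 j.+1.
Proof.
move=> e; have /eq_in_map : map c.2 (iota 0 k) = map d.2 (iota 0 k).
  exact: (congr1 behead e).
by apply; rewrite mem_iota /k; lia.
Qed.

Lemma init_last n : init n j.+1 = n.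
Proof. by rewrite /init /= nth_rcons size_nseq ltnn eqxx. Qed.

(** The copier leaves the number of zeros free: fixing it would be circular, as it depends on a
    machine that computes the code of the copier. Counting the numbers on both tapes of a history
    forces it to be [j]. *)
Lemma intersectionP X Y :
  lang stepper [tuple X; Y] /\ lang (copier x) [tuple X; Y] <->
  exists n ps ms, [/\ history (machine_table D k) (halted D k) ps ms,
    flatten (unzip1 ps) ++ ms = conf k (0, init n) ++ flatten (unzip2 ps),
    X = unaries (conf k (0, init n) ++ flatten (unzip2 ps)) &
    Y = unaries (flatten (unzip2 ps))].
Proof.
rewrite history_lang copier_lang; split.
  case=> -[ps [ms [hh -> ->]]] [i [n]]; rewrite -unaries_cat => e.
  exists n, ps, ms; have [sms sps] := history_size hh.
  suff ij : i = j by rewrite conf_init -ij e; split=> //; apply: unaries_inj.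
  have := congr1 size (unaries_inj e).
  by rewrite /= !size_cat size_rcons size_nseq sms sps /k; lia.
case=> n [ps [ms [hh e -> ->]]]; split; first by exists ps, ms; rewrite e.
by exists j, n; rewrite conf_init unaries_cat.
Qed.

Let cap := lang_cap (leqnn 2) (lang stepper) (lang (copier x)).

Lemma capP X Y : cap [tuple X; Y] <->
  lang stepper [tuple X; Y] /\ lang (copier x) [tuple X; Y].
Proof.
rewrite /cap /lang_cap.
suff -> : [tuple tnth [tuple X; Y] (widen_ord (leqnn 2) k) | k < 2] = [tuple X; Y] by [].
by apply: eq_from_tnth => i; rewrite tnth_mktuple; congr tnth; apply: val_inj.
Qed.

Lemma rational_cap : (forall n, ~ halts D (0, init n)) -> rational cap.
Proof.
move=> hD; exists (regexp_automaton (Void : regexp action)) => z.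
rewrite regexp_automaton_lang; split=> [|[w []]].
have [X [Y ->]] := tuple2P z.
case/capP/intersectionP=> n [ps [ms [hh e _ _]]].
by case: (hD n); apply: (history_halts _ hh e).
Qed.

(** Tape 0 is cut after the initial configuration. Mixing two runs puts the initial configuration
    for one value of the last register in front of the second configuration for another value,
    although a step of [D] preserves that register. *)
Lemma not_rational_cap : (forall n, halts D (0, init n)) -> ~ rational cap.
Proof.
move=> hD [C hC].
pose V i v := exists w, v = unaries (conf k (mstep D (0, init i))) ++ w.
have [i|i [i' [_ [ne [w ->] [z []]]]]] :=
    @lang_mix _ _ C tape0 (fun i => unaries (conf k (0, init i))) V.
  have [ps [ms [hh e]]] := halts_history regDk (hD i).
  exists [tuple unaries (conf k (0, init i) ++ flatten (unzip2 ps));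
                unaries (flatten (unzip2 ps))], (unaries (flatten (unzip2 ps))).
  split; last 1 first.
  - case: ps hh e => [|[a b] ps] hh e.
      (* A history without steps would make the initial configuration halted, but address 0 is
         inside [D]. *)
      by move: hh.2; rewrite -[ms]/([::] ++ ms) e cats0 /= leqNgt D_gt0.
    have [-> _] := history_head regDk hh e.
    by exists (unaries (flatten (unzip2 ps))); rewrite -unaries_cat.
  - by apply/hC/capP/intersectionP; exists i, ps, ms.
  - by rewrite -unaries_cat.
have [X [Y ->]] := tuple2P z.
case/hC/capP/intersectionP=> n [ps [ms [hh e -> _]]].
rewrite -[tnth _ _]/(unaries (_ ++ flatten (unzip2 ps))) unaries_cat.
case/unaries_cat_inj=> [|en ew].
  by rewrite !size_conf.
have := conf_last_reg en; rewrite /= !init_last => ni.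
case: ps hh e ew => [|[a b] ps] hh e.
  by move: hh.2; rewrite -[ms]/([::] ++ ms) e cats0 /= leqNgt D_gt0.
have [eb _] := history_head regDk hh e.
rewrite -[flatten _]/(b ++ flatten (unzip2 ps)) eb unaries_cat.
case/unaries_cat_inj=> [|/conf_last_reg]; first by rewrite !size_conf.
rewrite !mstep_unused // /= !init_last ni => ii.
by rewrite ii eqxx in ne.
Qed.

End Instance.

Theorem theorem1 : ~ semidecidable code_instance rational_intersection.
Proof.
case=> M hM; pose K := (reg_bound M).+1.
move: (precompose_gt0 K instance_term M) (@precompose_halts M K instance_term).
(* [j >= K] makes the registers that [M] expects to be empty hold 0, and [j >= reg_bound D] keeps
   the last register out of reach of [D]. *)
move: (precompose _ _ _) => D D_gt0 hD; pose j := maxn K (reg_bound D).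
have regD : reg_bound D <= j by rewrite leq_maxr.
pose x := code_automaton (stepper D j).
(* On input [x], the machine [D] runs [M] on the code of the instance made of its own stepper and
   the copier for [x]. *)
have {}hD n : halts D (0, init j x n) <->
    rational (lang_cap (leqnn 2) (lang (stepper D j)) (lang (copier x))).
  rewrite hD ?closed_instance_term //.
    by rewrite -code_instance_copier hM.
  case=> // r /= rK; rewrite /init /= nth_rcons size_nseq nth_nseq.
  have -> : r < j by apply: (leq_trans _ (leq_maxl K _)); apply: ltnW.
  by [].
(* Rationality does not mention [n], so halting for one [n] gives halting for all of them. *)
have not_halts n : ~ halts D (0, init j x n).
  by move=> /hD h; apply: (not_rational_cap (x := x) regD D_gt0 _ h) => m; apply/hD.
by apply: (not_halts 0); apply/hD/rational_cap.
Qed.
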